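(* Over $\mathsf{RCA}_0$, $\mathsf{GST}_1$ is equivalent to $\mathsf{GS}^{\mathrm{cl}}$.
   Context: Work in second-order arithmetic; $\mathbb{N}$ denotes the natural numbers of a (possibly nonstandard) model. A countable second-countable (CSC) space is a tuple $\langle X,\mathcal{U},k\rangle$ where $X\subseteq\mathbb{N}$; $\mathcal{U}=\langle U_n:n\in\mathbb{N}\rangle$ is a sequence of subsets of $X$ such that every $x\in X$ belongs to some $U_n$; and $k:X\times\mathbb{N}\times\mathbb{N}\to\mathbb{N}$ is a function such that whenever $x\in U_m\cap U_n$ we have $x\in U_{k(x,m,n)}\subseteq U_m\cap U_n$. Write $U\in\mathcal{U}$ if $U=U_n$ for some $n$. The space is infinite if $X$ is infinite. For $Y\subseteq X$ the subspace $Y$ is $\langle Y,\langle U_n\cap Y\rangle,k\rangle$. A CSC space is: indiscrete if every $U\in\mathcal{U}$ is $\emptyset$ or $X$; discrete if $\{x\}\in\mathcal{U}$ for all $x\in X$; has the initial segment topology if $X$ is infinite and there is a bijection $h:\mathbb{N}\to X$ with $U\in\mathcal{U}$ iff $U$ is $\emptyset$, $X$, or $\{h(i):i\le j\}$ for some $j$; has the final segment topology if likewise with $\{h(i):i\ge j\}$; has the cofinite topology if $X$ is infinite and $U\in\mathcal{U}$ iff $U=\emptyset$ or $X\setminus U$ is finite; is $T_1$ if for all $x\ne y$ in $X$ there are $U,V\in\mathcal{U}$ with $x\in U\setminus V$, $y\in V\setminus U$. The closure relation is the set $\mathrm{cl}\subseteq X^2$ with $\langle y,x\rangle\in\mathrm{cl}$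 iff every $U\in\mathcal{U}$ containing $y$ contains $x$. $\mathsf{GS}$ is the statement that every infinite CSC space has an infinite subspace which is indiscrete, has the initial segment topology, has the final segment topology, is discrete, or has the cofinite topology. $\mathsf{GS}^{\mathrm{cl}}$ is $\mathsf{GS}$ restricted to CSC spaces whose closure relation exists (as a set). $\mathsf{GST}_1$ is $\mathsf{GS}$ restricted to $T_1$ CSC spaces.
   Formalization: In the initial segment, final segment and cofinite topologies, ''U ∈ 𝒰 iff'' is read as ''U is open (a union of members of 𝒰) iff''; with U = U_n literally, both principles are refutable (for GS^cl: X = ℕ, U_n = {0,…,n}). *)

(* Defs.v *)
(** * Two-sorted structures for second-order arithmetic *)

(** Henkin structures: the second sort is arbitrary, and the first-order part
    may be nonstandard. Equality of sets is not primitive; it is extensional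
    equality, as usual in the language of second-order arithmetic. *)
Record L2struct : Type := {
  num : Type;
  set : Type;
  zero : num;
  one : num;
  add : num -> num -> num;
  mul : num -> num -> num;
  lt : num -> num -> Prop;
  mem : num -> set -> Prop }.

Declare Scope L2_scope.
Delimit Scope L2_scope with L2.
Local Open Scope L2_scope.

Notation "0" := (zero _) : L2_scope.
Notation "1" := (one _) : L2_scope.
Notation "x + y" := (add _ x y) : L2_scope.
Notation "x * y" := (mul _ x y) : L2_scope.
Notation "x < y" := (lt _ x y) : L2_scope.
Notation "x <= y" := (lt _ x y \/ x = y) : L2_scope.
Notation "x ∈ A" := (mem _ x A) (at level 70) : L2_scope.

(** * Formulas *)

Inductive term : Type :=
| TVar (i : nat)
| TZero
| TOne
| TAdd (s t : term)
| TMul (s t : term).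

(** Formulas all of whose quantifiers are bounded number quantifiers. Number
    variables are de Bruijn indices: [DAllLt t p] and [DExLt t p] bind index 0
    in [p] but not in the bound [t]. Set variables are free (parameters). *)
Inductive d0form : Type :=
| DFalse
| DEq (s t : term)
| DLt (s t : term)
| DMem (t : term) (X : nat)
| DImp (p q : d0form)
| DAnd (p q : d0form)
| DOr (p q : d0form)
| DAllLt (t : term) (p : d0form)
| DExLt (t : term) (p : d0form).

Definition scons {A : Type} (a : A) (e : nat -> A) (i : nat) : A :=
  match i with O => a | S j => e j end.

Section Semantics.
Variable M : L2struct.
Implicit Types (e : nat -> num M) (s : nat -> set M).

Fixpoint teval e (t : term) : num M :=
  match t with
  | TVar i => e i
  | TZero => 0
  | TOne => 1
  | TAdd t u => teval e t + teval e u
  | TMul t u => teval e t * teval e u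
  end.

Fixpoint d0sat e s (p : d0form) : Prop :=
  match p with
  | DFalse => False
  | DEq t u => teval e t = teval e u
  | DLt t u => teval e t < teval e u
  | DMem t X => teval e t ∈ s X
  | DImp p q => d0sat e s p -> d0sat e s q
  | DAnd p q => d0sat e s p /\ d0sat e s q
  | DOr p q => d0sat e s p \/ d0sat e s q
  | DAllLt t p => forall x, x < teval e t -> d0sat (scons x e) s p
  | DExLt t p => exists x, x < teval e t /\ d0sat (scons x e) s p
  end.

(** [p] is read as the Σ⁰₁ formula [∃ m, p], resp. the Π⁰₁ formula [∀ m, p],
    the quantified variable being index 0. *)
Definition sigma1sat e s (p : d0form) : Prop :=
  exists m, d0sat (scons m e) s p.

Definition pi1sat e s (p : d0form) : Prop :=
  forall m, d0sat (scons m e) s p.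

(** * The axioms of RCA₀ *)

Record basic_axioms : Prop := {
  succ_neq_0 : forall n : num M, n + 1 <> 0;
  succ_inj : forall m n : num M, m + 1 = n + 1 -> m = n;
  add_zero : forall m : num M, m + 0 = m;
  add_succ : forall m n : num M, m + (n + 1) = (m + n) + 1;
  mul_zero : forall m : num M, m * 0 = 0;
  mul_succ : forall m n : num M, m * (n + 1) = (m * n) + m;
  lt_zero : forall m : num M, ~ m < 0;
  lt_succ : forall m n : num M, m < n + 1 <-> m <= n }.

Definition sigma1_induction : Prop :=
  forall (p : d0form) e s,
    sigma1sat (scons 0 e) s p ->
    (forall n, sigma1sat (scons n e) s p -> sigma1sat (scons (n + 1) e) s p) ->
    forall n, sigma1sat (scons n e) s p.

Definition delta1_comprehension : Prop :=
  forall (p q : d0form) e s,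
    (forall n, sigma1sat (scons n e) s p <-> pi1sat (scons n e) s q) ->
    exists X : set M, forall n, n ∈ X <-> sigma1sat (scons n e) s p.

Definition RCA0 : Prop :=
  basic_axioms /\ sigma1_induction /\ delta1_comprehension.

(** * Coding inside the structure *)

Implicit Types (i j m n v x y z : num M) (A B X Y : set M).

Definition subset A B : Prop := forall x, x ∈ A -> x ∈ B.

Definition seteq A B : Prop := forall x, x ∈ A <-> x ∈ B.

Definition empty A : Prop := forall x, ~ x ∈ A.

Definition finite A : Prop := exists b, forall x, x ∈ A -> x < b.

Definition infinite A : Prop := ~ finite A.

(** The usual pairing of second-order arithmetic, [(x + y)² + x]; it is
    injective in models of RCA₀, but not onto. *)
Definition pair x y : num M := (x + y) * (x + y) + x.

(** [H] is (the graph of) a bijection from the natural numbers onto [X]. *)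
Definition bijection_onto (H X : set M) : Prop :=
  (forall z, z ∈ H -> exists i x, x ∈ X /\ z = pair i x) /\
  (forall i, exists! x, pair i x ∈ H) /\
  (forall x, x ∈ X -> exists! i, pair i x ∈ H).

(** * Countable second-countable spaces *)

(** The sequence ⟨Uₙ⟩ is coded by [base], see [inU]; [kfun] is the graph of
    the function k. *)
Record space : Type := {
  pts : set M;
  base : set M;
  kfun : set M }.

Implicit Types S T : space.

Definition inU S x n : Prop := pair x n ∈ base S.

Definition kcode x m n v : num M := pair (pair (pair x m) n) v.

Definition is_csc S : Prop :=
  (forall z, z ∈ base S -> exists x n, x ∈ pts S /\ z = pair x n) /\
  (forall x, x ∈ pts S -> exists n, inU S x n) /\
  (forall z, z ∈ kfun S ->
     exists x m n v, x ∈ pts S /\ z = kcode x m n v) /\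
  (forall x m n, x ∈ pts S -> exists! v, kcode x m n v ∈ kfun S) /\
  (forall x m n v, inU S x m -> inU S x n -> kcode x m n v ∈ kfun S ->
     inU S x v /\ forall y, inU S y v -> inU S y m /\ inU S y n).

(** The set [A] is one of the Uₙ. *)
Definition basic S A : Prop := exists n, forall x, x ∈ A <-> inU S x n.

(** [A] is open in the topology having the Uₙ as a base. *)
Definition open_set S A : Prop :=
  subset A (pts S) /\
  forall x, x ∈ A -> exists B, basic S B /\ x ∈ B /\ subset B A.

Definition indiscrete S : Prop :=
  forall A, basic S A -> empty A \/ seteq A (pts S).

Definition discrete S : Prop :=
  forall x, x ∈ pts S -> exists A, basic S A /\ forall y, y ∈ A <-> y = x.

(** The next three notions prescribe an entire topology, so they constrain the
    open sets and not the particular base. Requiring the Uₙ themselves to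
    exhaust the listed sets would be too strong: with Uₙ = {0, ..., n}, no
    infinite subspace Y has Y itself among the sets Uₙ ∩ Y. Being indiscrete,
    discrete or T₁ does not depend on this choice. *)
Definition initial_segment_topology S : Prop :=
  infinite (pts S) /\
  exists H, bijection_onto H (pts S) /\
    forall A, open_set S A <->
      empty A \/ seteq A (pts S) \/
      exists j, forall x, x ∈ A <-> exists i, i <= j /\ pair i x ∈ H.

Definition final_segment_topology S : Prop :=
  infinite (pts S) /\
  exists H, bijection_onto H (pts S) /\
    forall A, open_set S A <->
      empty A \/ seteq A (pts S) \/
      exists j, forall x, x ∈ A <-> exists i, j <= i /\ pair i x ∈ H.

Definition cofinite_topology S : Prop :=
  infinite (pts S) /\
  forall A, subset A (pts S) ->
    (open_set S A <->
     empty A \/ exists b, forall x, x ∈ pts S -> ~ x ∈ A -> x < b).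

Definition T1_space S : Prop :=
  forall x y, x ∈ pts S -> y ∈ pts S -> x <> y ->
  exists A B, basic S A /\ basic S B /\
    (x ∈ A /\ ~ x ∈ B) /\ (y ∈ B /\ ~ y ∈ A).

Definition closure_relation_exists S : Prop :=
  exists C : set M, forall z, z ∈ C <->
    exists y x, y ∈ pts S /\ x ∈ pts S /\ z = pair y x /\
      forall A, basic S A -> y ∈ A -> x ∈ A.

(** [T] is the subspace ⟨Y, ⟨Uₙ ∩ Y⟩, k⟩ of [S], where Y is [pts T] and k is
    restricted to arguments with first coordinate in Y. *)
Definition is_subspace T S : Prop :=
  subset (pts T) (pts S) /\
  (forall z, z ∈ base T <->
     z ∈ base S /\ exists x n, x ∈ pts T /\ z = pair x n) /\
  (forall z, z ∈ kfun T <->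
     z ∈ kfun S /\ exists x m n v, x ∈ pts T /\ z = kcode x m n v).

(** * The Ginsburg–Sands principles *)

Definition GS_conclusion S : Prop :=
  exists T, is_subspace T S /\ infinite (pts T) /\
    (indiscrete T \/ initial_segment_topology T \/ final_segment_topology T \/
     discrete T \/ cofinite_topology T).

Definition GS_restricted (P : space -> Prop) : Prop :=
  forall S, is_csc S -> infinite (pts S) -> P S -> GS_conclusion S.

Definition GST1 : Prop := GS_restricted T1_space.

Definition GScl : Prop := GS_restricted closure_relation_exists.

End Semantics.

(* Main.v *)
(** In a T₁ space the closure relation is equality, so it exists. Conversely the
    closure relation is a preorder on the points, and it suffices to find an
    infinite set on which it is total and symmetric, or a strict chain of order
    type ω or ω*, or equality: the first three give the indiscrete, final segment
    and initial segment topologies, and the last gives a T₁ subspace, to which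
    GST₁ applies. Such a set is found with GST₁ itself. For a transitive relation
    Q on X, the sets {x} ∪ {y : Q x y, y > b} are a base of a T₁ topology on X;
    a discrete infinite subspace Y is one in which every cone {y : Q x y} with x
    in Y is finite, and in a cofinite one every such cone is cofinite. Apply this
    to the preorder and to its converse. A cofinite outcome yields a chain by a
    greedy choice. If both outcomes are discrete, every point is comparable to
    finitely many others and the greedy antichain is infinite; here a bounded
    union of finite sets must be finite, a principle not available in RCA₀, which
    follows by applying the dichotomy to the relation f x ≤ f y for a bounded f. *)

From Stdlib Require Import Classical Arith Ring.
Require Import Defs.
Local Open Scope L2_scope.

(** * Renaming of variables and parameters in formulas *)

Fixpoint tren (r : nat -> nat) (t : term) : term :=
  match t with
  | TVar i => TVar (r i)
  | TZero => TZero
  | TOne => TOne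
  | TAdd t u => TAdd (tren r t) (tren r u)
  | TMul t u => TMul (tren r t) (tren r u)
  end.

Definition up (r : nat -> nat) (i : nat) : nat :=
  match i with O => O | S j => S (r j) end.

Fixpoint dren (r q : nat -> nat) (p : d0form) : d0form :=
  match p with
  | DFalse => DFalse
  | DEq t u => DEq (tren r t) (tren r u)
  | DLt t u => DLt (tren r t) (tren r u)
  | DMem t X => DMem (tren r t) (q X)
  | DImp a b => DImp (dren r q a) (dren r q b)
  | DAnd a b => DAnd (dren r q a) (dren r q b)
  | DOr a b => DOr (dren r q a) (dren r q b)
  | DAllLt t a => DAllLt (tren r t) (dren (up r) q a)
  | DExLt t a => DExLt (tren r t) (dren (up r) q a)
  end.

(** Even indices carry the variables, odd indices the constants. *)
Definition mix {A : Type} (e c : nat -> A) (i : nat) : A :=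
  if Nat.even i then e (Nat.div2 i) else c (Nat.div2 i).

Lemma mix_var {A} (e c : nat -> A) i : mix e c (2 * i) = e i.
Proof. unfold mix. rewrite Nat.even_mul, Nat.div2_double. reflexivity. Qed.

Lemma mix_const {A} (e c : nat -> A) i : mix e c (2 * i + 1) = c i.
Proof.
  unfold mix. rewrite Nat.even_add, Nat.even_mul, Nat.add_1_r, Nat.div2_succ_double.
  reflexivity.
Qed.

(** Two formulas with parameter lists [c] and [c'] can be joined by a connective only over one list,
    [mix c c']. [constL] and [constR] redirect the parameters of the first and of the second formula
    to their places in it, and leave the variables alone. *)
Definition constL (i : nat) : nat :=
  if Nat.even i then i else 2 * (2 * Nat.div2 i) + 1.
Definition constR (i : nat) : nat :=
  if Nat.even i then i else 2 * (2 * Nat.div2 i + 1) + 1.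

Lemma mix_constL {A} (e c c' : nat -> A) i :
  mix e (mix c c') (constL i) = mix e c i.
Proof.
  unfold constL. destruct (Nat.even i) eqn:E.
  - unfold mix at 1 3. now rewrite E.
  - rewrite mix_const, mix_var. unfold mix. now rewrite E.
Qed.

Lemma mix_constR {A} (e c c' : nat -> A) i :
  mix e (mix c c') (constR i) = mix e c' i.
Proof.
  unfold constR. destruct (Nat.even i) eqn:E.
  - unfold mix at 1 3. now rewrite E.
  - rewrite mix_const, mix_const. unfold mix. now rewrite E.
Qed.

(** A bounded quantifier pushes its value in front of the whole interleaved assignment, whereas the
    body is known to be definable when the value is pushed onto the variables only. This renaming
    passes from one layout to the other. *)
Definition bind_var (i : nat) : nat :=
  if Nat.even i then match i with O => O | S (S j) => S j | _ => O end else S i.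

Lemma mix_bind {A} (x : A) (e c : nat -> A) i :
  scons x (mix e c) (bind_var i) = mix (scons x e) c i.
Proof.
  unfold bind_var. destruct (Nat.even i) eqn:E.
  - destruct i as [|[|i]]; try discriminate E; try reflexivity.
    change (Nat.even i = true) in E. simpl. unfold mix at 2. simpl.
    rewrite E. simpl. unfold mix. now rewrite E.
  - simpl. unfold mix. now rewrite E.
Qed.

Section Model.
(** A set witnesses that the second sort is inhabited, as an assignment of set
    variables requires. *)
Context {M : L2struct} (HM : RCA0 M) (W : set M).

Implicit Types (e c : nat -> num M) (X Y : set M).

Lemma teval_ren t r e e' :
  (forall i, e (r i) = e' i) -> teval M e (tren r t) = teval M e' t.
Proof. intros H. induction t; simpl; congruence. Qed.

Lemma d0sat_ren p : forall r q e e' v v',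
  (forall i, e (r i) = e' i) -> (forall i, v (q i) = v' i) ->
  (d0sat M e v (dren r q p) <-> d0sat M e' v' p).
Proof.
  induction p; intros r q e e' v v' He Hs; simpl;
    rewrite ?(teval_ren _ r e e' He), ?Hs; try reflexivity;
    try (rewrite (IHp1 r q e e' v v' He Hs), (IHp2 r q e e' v v' He Hs); reflexivity).
  - assert (K : forall x, d0sat M (scons x e) v (dren (up r) q p)
                     <-> d0sat M (scons x e') v' p).
    { intros x. apply IHp; auto. intros [|i]; simpl; auto. }
    split; intros H x Hx; apply K, H, Hx.
  - assert (K : forall x, d0sat M (scons x e) v (dren (up r) q p)
                     <-> d0sat M (scons x e') v' p).
    { intros x. apply IHp; auto. intros [|i]; simpl; auto. }
    split; intros [x [Hx H]]; exists x; split; auto; now apply K.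
Qed.

(** * Predicates definable with parameters *)

(** Definability is a property of Rocq functions and predicates on assignments, closed under the
    connectives and bounded quantifiers. Induction and comprehension can then be applied to ordinary
    predicates without writing out a formula. *)
Definition defT (f : (nat -> num M) -> num M) : Prop :=
  exists t c, forall e, teval M (mix e c) t = f e.

Definition defD (P : (nat -> num M) -> Prop) : Prop :=
  exists p c s, forall e, d0sat M (mix e c) s p <-> P e.

Lemma defT_var i : defT (fun e => e i).
Proof.
  exists (TVar (2 * i)), (fun _ => 0). intros e. apply mix_var.
Qed.

Lemma defT_const (a : num M) : defT (fun _ => a).
Proof.
  exists (TVar (2 * 0 + 1)), (fun _ => a). intros e. apply mix_const.
Qed.

Lemma defT_ren r f : defT f -> defT (fun e => f (fun i => e (r i))).
Proof.
  intros (t & c & Ht).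
  exists (tren (fun i => if Nat.even i then 2 * r (Nat.div2 i) else i)%nat t), c.
  intros e. rewrite <- (Ht (fun i => e (r i))). apply teval_ren. intros i.
  destruct (Nat.even i) eqn:E.
  - rewrite mix_var. unfold mix. now rewrite E.
  - unfold mix. now rewrite E.
Qed.

Lemma defT_merge f g : defT f -> defT g -> exists t u c,
  forall e, teval M (mix e c) t = f e /\ teval M (mix e c) u = g e.
Proof.
  intros (t & c & Ht) (u & d & Hu).
  exists (tren constL t), (tren constR u), (mix c d). intros e. split.
  - rewrite <- Ht. apply teval_ren, mix_constL.
  - rewrite <- Hu. apply teval_ren, mix_constR.
Qed.

Lemma defT_add f g : defT f -> defT g -> defT (fun e => f e + g e).
Proof.
  intros Hf Hg. destruct (defT_merge f g Hf Hg) as (t & u & c & H).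
  exists (TAdd t u), c. intros e. simpl. now destruct (H e) as [-> ->].
Qed.

Lemma defT_mul f g : defT f -> defT g -> defT (fun e => f e * g e).
Proof.
  intros Hf Hg. destruct (defT_merge f g Hf Hg) as (t & u & c & H).
  exists (TMul t u), c. intros e. simpl. now destruct (H e) as [-> ->].
Qed.

Lemma defT_pair f g : defT f -> defT g -> defT (fun e => pair M (f e) (g e)).
Proof.
  intros Hf Hg. unfold pair.
  apply defT_add; [apply defT_mul; apply defT_add|]; assumption.
Qed.

Lemma defD_mem f X : defT f -> defD (fun e => f e ∈ X).
Proof.
  intros (t & c & Ht). exists (DMem t 0), c, (fun _ => X).
  intros e. simpl. now rewrite Ht.
Qed.

Lemma defD_eq f g : defT f -> defT g -> defD (fun e => f e = g e).
Proof.
  intros Hf Hg. destruct (defT_merge f g Hf Hg) as (t & u & c & H).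
  exists (DEq t u), c, (fun _ => W). intros e. simpl.
  destruct (H e) as [-> ->]. reflexivity.
Qed.

Lemma defD_lt f g : defT f -> defT g -> defD (fun e => f e < g e).
Proof.
  intros Hf Hg. destruct (defT_merge f g Hf Hg) as (t & u & c & H).
  exists (DLt t u), c, (fun _ => W). intros e. simpl.
  destruct (H e) as [-> ->]. reflexivity.
Qed.

Lemma defD_merge P Q : defD P -> defD Q -> exists p q c v,
  forall e, (d0sat M (mix e c) v p <-> P e) /\ (d0sat M (mix e c) v q <-> Q e).
Proof.
  intros (p & c & v & Hp) (q & d & w & Hq).
  exists (dren constL (fun i => 2 * i)%nat p),
    (dren constR (fun i => 2 * i + 1)%nat q), (mix c d), (mix v w).
  intros e. split.
  - rewrite <- Hp. apply d0sat_ren; [apply mix_constL | apply mix_var].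
  - rewrite <- Hq. apply d0sat_ren; [apply mix_constR | apply mix_const].
Qed.

Lemma defD_imp P Q : defD P -> defD Q -> defD (fun e => P e -> Q e).
Proof.
  intros HP HQ. destruct (defD_merge P Q HP HQ) as (p & q & c & v & H).
  exists (DImp p q), c, v. intros e. simpl. destruct (H e). tauto.
Qed.

Lemma defD_and P Q : defD P -> defD Q -> defD (fun e => P e /\ Q e).
Proof.
  intros HP HQ. destruct (defD_merge P Q HP HQ) as (p & q & c & v & H).
  exists (DAnd p q), c, v. intros e. simpl. destruct (H e). tauto.
Qed.

Lemma defD_or P Q : defD P -> defD Q -> defD (fun e => P e \/ Q e).
Proof.
  intros HP HQ. destruct (defD_merge P Q HP HQ) as (p & q & c & v & H).
  exists (DOr p q), c, v. intros e. simpl. destruct (H e). tauto.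
Qed.

(** The truth value does not depend on the assignment, so by excluded middle a trivially true or a
    false formula expresses it, whatever the complexity of [A]. *)
Lemma defD_prop (A : Prop) : defD (fun _ => A).
Proof.
  destruct (classic A) as [H|H].
  - exists (DImp DFalse DFalse), (fun _ => 0), (fun _ => W). simpl. tauto.
  - exists DFalse, (fun _ => 0), (fun _ => W). simpl. tauto.
Qed.

Lemma defD_not P : defD P -> defD (fun e => ~ P e).
Proof. intros H. apply (defD_imp P (fun _ => False) H), defD_prop. Qed.

Lemma defD_iff P Q : defD P -> defD Q -> defD (fun e => P e <-> Q e).
Proof.
  intros HP HQ. apply (defD_and (fun e => P e -> Q e) (fun e => Q e -> P e));
  now apply defD_imp.
Qed.

Lemma defD_bind f (P : num M -> (nat -> num M) -> Prop) :
  defT f -> defD (fun e => P (e 0%nat) (fun i => e (S i))) ->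
  exists t p c v, forall e, teval M (mix e c) t = f e /\
    forall x, d0sat M (scons x (mix e c)) v p <-> P x e.
Proof.
  intros (t & c & Ht) (p & d & v & Hp).
  exists (tren constL t), (dren (fun i => bind_var (constR i)) (fun i => i) p),
    (mix c d), v.
  intros e. split.
  - rewrite <- Ht. apply teval_ren, mix_constL.
  - intros x. rewrite <- (Hp (scons x e)). apply d0sat_ren; [|reflexivity].
    intros i. now rewrite mix_bind, mix_constR.
Qed.

Lemma defD_all_lt f (P : num M -> (nat -> num M) -> Prop) :
  defT f -> defD (fun e => P (e 0%nat) (fun i => e (S i))) ->
  defD (fun e => forall x, x < f e -> P x e).
Proof.
  intros Hf HP. destruct (defD_bind f P Hf HP) as (t & p & c & v & H).
  exists (DAllLt t p), c, v. intros e. simpl. destruct (H e) as [-> K].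
  split; intros L x Hx; apply K, L, Hx.
Qed.

Lemma defD_ex_lt f (P : num M -> (nat -> num M) -> Prop) :
  defT f -> defD (fun e => P (e 0%nat) (fun i => e (S i))) ->
  defD (fun e => exists x, x < f e /\ P x e).
Proof.
  intros Hf HP. destruct (defD_bind f P Hf HP) as (t & p & c & v & H).
  exists (DExLt t p), c, v. intros e. simpl. destruct (H e) as [-> K].
  split; intros [x [Hx L]]; exists x; split; auto; now apply K.
Qed.

(** Quantifying over definable terms builds closure under substitution into the notion, so that a
    hypothesis of this kind applies at any arguments during proof search. *)
Definition def1 (P : num M -> Prop) : Prop :=
  forall f, defT f -> defD (fun e => P (f e)).

Definition def2 (P : num M -> num M -> Prop) : Prop :=
  forall f g, defT f -> defT g -> defD (fun e => P (f e) (g e)).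

Definition def3 (P : num M -> num M -> num M -> Prop) : Prop :=
  forall f g h, defT f -> defT g -> defT h -> defD (fun e => P (f e) (g e) (h e)).

(** * Induction and comprehension for Σ⁰₁ predicates *)

Definition sig1 (P : num M -> Prop) : Prop :=
  exists Q : num M -> num M -> Prop, def2 Q /\ forall n, P n <-> exists m, Q m n.

Lemma sig1_form P P' : sig1 P -> sig1 P' -> exists p q e v,
  forall n, (sigma1sat M (scons n e) v p <-> P n) /\
            (pi1sat M (scons n e) v q <-> ~ P' n).
Proof.
  intros (Q & HQ & HP) (Q' & HQ' & HP').
  specialize (HQ _ _ (defT_var 0) (defT_var 1)).
  specialize (HQ' _ _ (defT_var 0) (defT_var 1)).
  destruct (defD_merge _ _ HQ HQ') as (p & q & c & v & H).
  (* Passes from the interleaved layout to the one of [sigma1sat]: the witness at index 0, the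
     argument at index 1, the parameters from index 2 on. *)
  set (r := fun i => if Nat.even i then match i with O => 0%nat | _ => 1%nat end
                     else S (S (Nat.div2 i))).
  assert (K : forall n m a, d0sat M (scons m (scons n c)) v (dren r (fun i => i) a)
     <-> d0sat M (mix (scons m (fun _ => n)) c) v a).
  { intros n m a. apply d0sat_ren; [|reflexivity]. intros i. unfold r, mix.
    destruct (Nat.even i) eqn:E; [|reflexivity].
    destruct i as [|[|i]]; [reflexivity|discriminate E|reflexivity]. }
  exists (dren r (fun i => i) p), (DImp (dren r (fun i => i) q) DFalse), c, v.
  intros n. split.
  - rewrite HP. split; intros [m L]; exists m; [apply K in L|apply K]; now apply H in L || apply H.
  - rewrite HP'. unfold pi1sat. simpl. split.
    + intros L [m L']. apply (L m), K, H, L'.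
    + intros L m L'. apply L. exists m. now apply K, H in L'.
Qed.

Lemma sig1_def P : def1 P -> sig1 P.
Proof.
  intros H. exists (fun _ n => P n). split.
  - intros f g _ Hg. now apply H.
  - intros n. split; [now exists 0 | now intros [_ L]].
Qed.

Lemma sig1_ex P : def2 P -> sig1 (fun n => exists m, P m n).
Proof.
  intros H. exists P. split; [assumption|reflexivity].
Qed.

Lemma sigma1_ind P : sig1 P -> P 0 -> (forall n, P n -> P (n + 1)) -> forall n, P n.
Proof.
  intros H. destruct (sig1_form P P H H) as (p & q & e & v & K).
  intros H0 HS n. apply K. destruct HM as (_ & I & _). apply I.
  - now apply K.
  - intros k L. apply K, HS, K, L.
Qed.

Lemma delta1_comp P :
  sig1 P -> sig1 (fun n => ~ P n) -> exists X, forall n, n ∈ X <-> P n.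
Proof.
  intros H H'. destruct (sig1_form P _ H H') as (p & q & e & v & K).
  destruct HM as (_ & _ & C). destruct (C p q e v) as [X HX].
  - intros n. destruct (K n) as [-> ->]. split; [tauto | apply NNPP].
  - exists X. intros n. rewrite HX. apply K.
Qed.

Lemma def_comp P : def1 P -> exists X, forall n, n ∈ X <-> P n.
Proof.
  intros H. apply delta1_comp; apply sig1_def; [assumption|].
  intros f Hf. now apply defD_not, H.
Qed.

Lemma ind P : def1 P -> P 0 -> (forall n, P n -> P (n + 1)) -> forall n, P n.
Proof. intros H. now apply sigma1_ind, sig1_def. Qed.

Ltac deft := first
  [ assumption | apply defT_var | apply defT_const
  | apply defT_pair; deft | apply defT_add; deft | apply defT_mul; deft
  | apply defT_ren; assumption ].

(** A hook for further definable predicates; it is redefined once [coded] is available. *)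
Ltac defd_step := fail.
Ltac defd := cbv beta; first
  [ assumption
  | deft
  | defd_step
  | apply defD_prop
  | apply defD_all_lt; defd | apply defD_ex_lt; defd
  | apply defD_eq; deft | apply defD_lt; deft | apply defD_mem; deft
  | apply defD_iff; defd | apply defD_not; defd
  | apply defD_and; defd | apply defD_or; defd | apply defD_imp; defd
  | match goal with
    | H : def1 _ |- _ => apply H; deft
    | H : def2 _ |- _ => apply H; deft
    | H : def3 _ |- _ => apply H; deft
    end ].
Ltac def := unfold def1, def2, def3; intros; defd.

(** * Arithmetic *)

Implicit Types x y z m n k i j a b t u w : num M.

Let axioms : basic_axioms M := proj1 HM.

Lemma add_0_l n : 0 + n = n.
Proof.
  revert n. apply ind; [def| |].
  - apply (add_zero _ axioms).
  - intros n H. rewrite (add_succ _ axioms). congruence.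
Qed.

Lemma add_succ_l m n : m + 1 + n = m + n + 1.
Proof.
  revert n. apply ind; [def| |].
  - now rewrite !(add_zero _ axioms).
  - intros n H. rewrite !(add_succ _ axioms). congruence.
Qed.

Lemma add_comm m n : m + n = n + m.
Proof.
  revert n. apply ind; [def| |].
  - now rewrite add_0_l, (add_zero _ axioms).
  - intros n H. rewrite (add_succ _ axioms), add_succ_l. congruence.
Qed.

Lemma add_assoc m n k : m + (n + k) = m + n + k.
Proof.
  revert k. apply ind; [def| |].
  - now rewrite !(add_zero _ axioms).
  - intros k H. rewrite !(add_succ _ axioms). congruence.
Qed.

Lemma mul_0_l n : 0 * n = 0.
Proof.
  revert n. apply ind; [def| |].
  - apply (mul_zero _ axioms).
  - intros n H. rewrite (mul_succ _ axioms), H. apply add_0_l.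
Qed.

Lemma mul_succ_l m n : (m + 1) * n = m * n + n.
Proof.
  revert n. apply ind; [def| |].
  - now rewrite !(mul_zero _ axioms), add_0_l.
  - intros n H. rewrite !(mul_succ _ axioms), H, !(add_succ _ axioms).
    rewrite <- !(add_assoc (m * n)). now rewrite (add_comm n m).
Qed.

Lemma mul_comm m n : m * n = n * m.
Proof.
  revert n. apply ind; [def| |].
  - now rewrite mul_0_l, (mul_zero _ axioms).
  - intros n H. rewrite (mul_succ _ axioms), mul_succ_l. congruence.
Qed.

Lemma mul_add_l m n k : (m + n) * k = m * k + n * k.
Proof.
  revert k. apply ind; [def| |].
  - now rewrite !(mul_zero _ axioms), add_0_l.
  - intros k H. rewrite !(mul_succ _ axioms), H.
    rewrite <- !add_assoc. f_equal. rewrite !add_assoc. f_equal. apply add_comm.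
Qed.

Lemma mul_assoc m n k : m * (n * k) = m * n * k.
Proof.
  revert m. apply ind; [def| |].
  - now rewrite !mul_0_l.
  - intros m H. rewrite !mul_succ_l, mul_add_l. congruence.
Qed.

Lemma mul_1_l n : 1 * n = n.
Proof.
  rewrite <- (add_0_l 1), mul_succ_l, mul_0_l. apply add_0_l.
Qed.

Lemma num_srt : semi_ring_theory (zero M) (one M) (add M) (mul M) (@eq (num M)).
Proof.
  constructor; eauto using add_0_l, add_comm, add_assoc, mul_1_l, mul_0_l,
    mul_comm, mul_assoc, mul_add_l.
Qed.
Add Ring num_ring : num_srt.

Lemma add_cancel m n k : m + k = n + k -> m = n.
Proof.
  revert k. apply (ind (fun k => m + k = n + k -> m = n)); [def| |].
  - now rewrite !(add_zero _ axioms).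
  - intros k H. rewrite !(add_succ _ axioms). intros L. apply H, (succ_inj _ axioms), L.
Qed.

Lemma succ_not_0 k : k + 1 <> 0.
Proof. apply (succ_neq_0 _ axioms). Qed.

Lemma lt_ex x y : x < y <-> exists t, y = x + t + 1.
Proof.
  split.
  (* The implication is kept under the quantifier so that the induction statement is Σ⁰₁. *)
  - assert (H : forall y, exists t, x < y -> y = x + t + 1).
    { apply sigma1_ind.
      - apply (sig1_ex (fun t y => x < y -> y = x + t + 1)). def.
      - exists 0. intros H. now apply (lt_zero _ axioms) in H.
      - intros n [t H]. destruct (classic (x < n)) as [L|L].
        + exists (t + 1). intros _. rewrite (H L). ring.
        + exists 0. intros K. apply (lt_succ _ axioms) in K.
          destruct K as [K| ->]; [now elim L | ring]. }
    destruct (H y) as [t L]. eauto.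
  - intros [t ->]. revert t. apply ind; [def| |].
    + apply (lt_succ _ axioms). right. ring.
    + intros t H. apply (lt_succ _ axioms). left.
      now rewrite add_assoc.
Qed.

Lemma lt_irrefl x : ~ x < x.
Proof.
  intros H. apply lt_ex in H. destruct H as [t H].
  apply (succ_not_0 t). apply (add_cancel _ _ x). rewrite H at 2. ring.
Qed.

Lemma lt_trans x y z : x < y -> y < z -> x < z.
Proof.
  rewrite !lt_ex. intros [t ->] [u ->]. exists (t + u + 1). ring.
Qed.

Lemma lt_plus1 x : x < x + 1.
Proof. apply lt_ex. exists 0. ring. Qed.

Lemma zero_or_succ x : x = 0 \/ exists y, x = y + 1.
Proof.
  assert (H : forall x, exists y, x = 0 \/ x = y + 1).
  { apply sigma1_ind.
    - apply (sig1_ex (fun y x => x = 0 \/ x = y + 1)). def.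
    - exists 0. auto.
    - intros n _. exists n. auto. }
  destruct (H x) as [y [K|K]]; eauto.
Qed.

Lemma zero_le x : 0 <= x.
Proof.
  destruct (zero_or_succ x) as [->|[y ->]]; [now right|left].
  apply lt_ex. exists y. ring.
Qed.

Lemma succ_le x y : x < y <-> x + 1 <= y.
Proof.
  split.
  - rewrite lt_ex. intros [t ->]. destruct (zero_or_succ t) as [->|[u ->]].
    + right. ring.
    + left. apply lt_ex. exists u. ring.
  - intros [H| <-]; [|apply lt_plus1].
    apply (lt_trans _ (x + 1)); [apply lt_plus1|assumption].
Qed.

Lemma lt_total x y : x < y \/ x = y \/ y < x.
Proof.
  revert y. apply ind; [def| |].
  - destruct (zero_le x); auto.
  - intros y [H|[->|H]].
    + left. apply (lt_trans _ y); [assumption|apply lt_plus1].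
    + left. apply lt_plus1.
    + apply succ_le in H. destruct H; auto.
Qed.

Lemma lt_le x y : x < y + 1 <-> x <= y.
Proof. apply (lt_succ _ axioms). Qed.

Lemma le_lt_trans x y z : x <= y -> y < z -> x < z.
Proof. intros [H| ->]; eauto using lt_trans. Qed.

Lemma lt_le_trans x y z : x < y -> y <= z -> x < z.
Proof. intros H [L| <-]; eauto using lt_trans. Qed.

Lemma le_trans x y z : x <= y -> y <= z -> x <= z.
Proof. intros [H| ->]; [|auto]. left. eauto using lt_le_trans. Qed.

Lemma not_lt x y : ~ x < y <-> y <= x.
Proof.
  split.
  - intros H. destruct (lt_total x y) as [L|[->|L]]; auto. now elim H.
  - intros H L. apply (lt_irrefl x). eauto using lt_le_trans.
Qed.

Lemma not_le x y : ~ x <= y <-> y < x.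
Proof. rewrite <- not_lt. split; [apply NNPP|tauto]. Qed.

Lemma le_add_r x y : x <= x + y.
Proof.
  destruct (zero_or_succ y) as [->|[t ->]]; [right; ring|left].
  apply lt_ex. exists t. ring.
Qed.

Lemma le_add_l x y : y <= x + y.
Proof. rewrite add_comm. apply le_add_r. Qed.

Lemma le_ex x y : x <= y <-> exists t, y = x + t.
Proof.
  split.
  - intros [H| ->]; [apply lt_ex in H; destruct H as [t ->]; exists (t + 1); ring|].
    exists 0. ring.
  - intros [t ->]. apply le_add_r.
Qed.

Lemma upper_bound x y : exists z, x < z /\ y < z.
Proof.
  exists (x + y + 1). split; apply lt_le; [apply le_add_r|apply le_add_l].
Qed.

Lemma le_sqr x : x <= x * x.
Proof.
  destruct (zero_or_succ x) as [->|[t ->]]; [right; ring|].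
  apply le_ex. exists (t * t + t). ring.
Qed.

Lemma pair_le x y : x <= pair M x y /\ y <= pair M x y.
Proof.
  unfold pair. split; [apply le_add_l|].
  apply (le_trans _ (x + y)); [apply le_add_l|].
  apply (le_trans _ ((x + y) * (x + y))); [apply le_sqr | apply le_add_r].
Qed.

(** With s = x + y, the code s² + x is at most s² + s, hence below (s + 1)². Equal codes therefore
    have equal sums, which is how injectivity follows. *)
Lemma pair_lt x y x' y' : x + y < x' + y' -> pair M x y < pair M x' y'.
Proof.
  intros H. apply lt_ex in H. destruct H as [t H]. unfold pair. rewrite H.
  apply lt_ex. exists (x + y + y + t * (x + y) + t * (x + y) + t * t + t + t + x'). ring.
Qed.

Lemma pair_inj x y x' y' : pair M x y = pair M x' y' -> x = x' /\ y = y'.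
Proof.
  intros H. destruct (lt_total (x + y) (x' + y')) as [L|[L|L]].
  - apply pair_lt in L. rewrite H in L. now apply lt_irrefl in L.
  - unfold pair in H. rewrite L in H.
    assert (E : x = x').
    { apply (add_cancel _ _ ((x' + y') * (x' + y'))).
      transitivity ((x' + y') * (x' + y') + x); [ring|]. rewrite H. ring. }
    split; [exact E|]. apply (add_cancel _ _ x').
    transitivity (x + y); [rewrite E; ring|]. rewrite L. ring.
  - apply pair_lt in L. rewrite H in L. now apply lt_irrefl in L.
Qed.

(** * Closure of Σ⁰₁ predicates, and their least and greatest elements *)

Lemma sig1_ex2 P : def3 P -> sig1 (fun n => exists a b, P a b n).
Proof.
  intros H. exists (fun m n => exists a, a < m /\ exists b, b < m /\ P a b n). split.
  - intros f g Hf Hg. defd.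
  - intros n. split.
    + intros (a & b & K). destruct (upper_bound a b) as (m & Ha & Hb). eauto 6.
    + intros (m & a & _ & b & _ & K). eauto.
Qed.

Lemma sig1_ex_and R P : def2 R -> sig1 P -> sig1 (fun n => exists x, R x n /\ P x).
Proof.
  intros HR (Q & HQ & H).
  destruct (sig1_ex2 (fun x m n => R x n /\ Q m x)) as (Q' & HQ' & H').
  { intros f g h Hf Hg Hh. defd. }
  exists Q'. split; [assumption|]. intros n. rewrite <- H'. split.
  - intros (x & K & L). apply H in L. destruct L as [m L]. eauto.
  - intros (x & m & K & L). exists x. split; [assumption|]. apply H. eauto.
Qed.

(** Induction on the negation of [P] would be Π⁰₁. Instead, if there were no least element, Σ⁰₁
    induction on [i] would give elements of [P] at distance at least [i] below [a], which is absurd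
    for [i = a + 1]. *)
Lemma least P a : sig1 P -> P a -> exists x, P x /\ forall y, y < x -> ~ P y.
Proof.
  intros H Ha. apply NNPP. intros N.
  assert (K : forall i, exists x, x + i <= a /\ P x).
  { apply sigma1_ind.
    - apply (sig1_ex_and (fun x i => x + i <= a)); [def|assumption].
    - exists a. split; [right; ring|assumption].
    - intros i (x & L & Hx). apply NNPP. intros C. apply N. exists x.
      split; [assumption|]. intros y Hy Py. apply C. exists y. split; [|assumption].
      apply (le_trans _ (x + i)); [|assumption].
      apply lt_ex in Hy. destruct Hy as [t ->]. apply le_ex. exists t. ring. }
  destruct (K (a + 1)) as (x & L & _).
  apply (lt_irrefl a). apply (lt_le_trans _ (x + (a + 1))); [|assumption].
  apply lt_ex. exists x. ring.
Qed.

Lemma greatest P a b : sig1 P -> P a -> (forall x, P x -> x < b) ->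
  exists x, P x /\ forall y, x < y -> ~ P y.
Proof.
  intros H Ha Hb. apply NNPP. intros N.
  assert (K : forall i, exists x, i <= x /\ P x).
  { apply sigma1_ind.
    - apply (sig1_ex_and (fun x i => i <= x)); [def|assumption].
    - exists a. split; [apply zero_le|assumption].
    - intros i (x & L & Hx). apply NNPP. intros C. apply N. exists x.
      split; [assumption|]. intros y Hy Py. apply C. exists y. split; [|assumption].
      apply succ_le. eauto using le_lt_trans. }
  destruct (K b) as (x & L & Px). apply Hb in Px.
  apply (lt_irrefl b). eauto using le_lt_trans.
Qed.

(** * Codes for finite sets *)

Definition dvd x y : Prop := exists q, y = x * q.

Lemma dvd_sub p x y : dvd p x -> dvd p (x + y) -> dvd p y.
Proof.
  intros [q ->] [r H]. destruct (lt_total r q) as [L|L].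
  (* Here [p * q + y = p * r] with [r < q], which forces [y = 0]. *)
  - apply lt_ex in L. destruct L as [t ->]. exists 0.
    destruct (zero_or_succ y) as [->|[u ->]]; [ring|].
    exfalso. apply (succ_not_0 (p * t + p + u)).
    apply (add_cancel _ _ (p * r)). transitivity (p * (r + t + 1) + (u + 1)); [ring|].
    rewrite H. ring.
  - assert (K : q <= r) by (destruct L; auto). apply le_ex in K.
    destruct K as [t ->]. exists t. apply (add_cancel _ _ (p * q)).
    rewrite add_comm, H. ring.
Qed.

Lemma dvd_mul p x y : dvd p x -> dvd p (x * y).
Proof. intros [q ->]. exists (q * y). ring. Qed.

(** Gödel's β-function, with [a] divisible by exactly the moduli of the members. *)
Definition modulus b i : num M := 1 + b * (i + 1).

(** The two moduli differ by [b * d], and a common divisor of a modulus and of a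
    power of [b] divides 1. *)
Lemma modulus_gauss b i d a : dvd d b ->
  dvd (modulus b i) (a * (b * d)) -> dvd (modulus b i) a.
Proof.
  intros [c Hc] H.
  assert (H1 : dvd (modulus b i) (a * b * b)).
  { apply (dvd_mul _ _ c) in H. rewrite Hc at 3.
    replace (a * b * (d * c)) with (a * (b * d) * c) by ring. exact H. }
  (* A factor [b] cancels because [modulus b i * x = x * b * (i + 1) + x]. *)
  assert (S : forall x, dvd (modulus b i) (x * b) -> dvd (modulus b i) x).
  { intros x K. apply (dvd_sub _ (x * b * (i + 1))).
    - now apply dvd_mul.
    - exists x. unfold modulus. ring. }
  apply S, S, H1.
Qed.

(** The coprimality of distinct moduli, in the form needed to multiply one more modulus into a code
    without adding other members. The indices differ by a positive number below [n], which divides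
    [b] by hypothesis, so [modulus_gauss] applies to the difference of the moduli. *)
Lemma modulus_prime b n i j a :
  (forall d, d < n -> d = 0 \/ dvd d b) -> i < n -> j < n -> i <> j ->
  dvd (modulus b i) (a * modulus b j) -> dvd (modulus b i) a.
Proof.
  intros Hb Hi Hj N H. destruct (lt_total i j) as [L|[L|L]]; [|easy|].
  - apply lt_ex in L. destruct L as [d ->].
    apply (modulus_gauss b i (d + 1)).
    + destruct (Hb (d + 1)) as [E|E]; [|now elim (succ_not_0 d)|exact E].
      apply (le_lt_trans _ (i + d + 1)); [|assumption].
      apply le_ex. exists i. ring.
    + apply (dvd_sub _ (a * modulus b i)); [exists a; ring|].
      replace (a * modulus b i + a * (b * (d + 1))) with (a * modulus b (i + d + 1)).
      * exact H.
      * unfold modulus. ring.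
  - apply lt_ex in L. destruct L as [d ->].
    apply (modulus_gauss b (j + d + 1) (d + 1)).
    + destruct (Hb (d + 1)) as [E|E]; [|now elim (succ_not_0 d)|exact E].
      apply (le_lt_trans _ (j + d + 1)); [|assumption].
      apply le_ex. exists j. ring.
    + apply (dvd_sub _ (a * modulus b j)); [exact H|].
      replace (a * modulus b j + a * (b * (d + 1))) with (modulus b (j + d + 1) * a).
      * now exists a.
      * unfold modulus. ring.
Qed.

(** In effect a factorial, built by Σ⁰₁ induction. The quotients are bounded inside the proof to
    keep the matrix of the induction statement bounded. *)
Lemma common_multiple n : exists b, b <> 0 /\ forall d, d < n -> d = 0 \/ dvd d b.
Proof.
  assert (H : forall n, exists b, b <> 0 /\
    forall d, d < n -> d = 0 \/ exists q, q < b + 1 /\ b = d * q).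
  { apply sigma1_ind.
    - apply (sig1_ex (fun b n => b <> 0 /\
        forall d, d < n -> d = 0 \/ exists q, q < b + 1 /\ b = d * q)). def.
    - exists (0 + 1). split; [apply succ_not_0|]. intros d L.
      now apply (lt_zero _ axioms) in L.
    (* The factor 0 is skipped, since the multiple must stay nonzero. *)
    - intros k (b & N & H). destruct (zero_or_succ k) as [->|[t ->]].
      + exists b. split; [assumption|]. intros d L. left. apply lt_le in L.
        destruct L as [L|L]; [now apply (lt_zero _ axioms) in L|assumption].
      + exists (b * (t + 1)). split.
        * destruct (zero_or_succ b) as [->|[u ->]]; [easy|].
          replace ((u + 1) * (t + 1)) with (u * t + u + t + 1) by ring. apply succ_not_0.
        * intros d L. apply lt_le in L. destruct L as [L| ->].
          -- destruct (H d L) as [E|(q & Hq & E)]; [now left|right].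
             exists (q * (t + 1)). split; [|rewrite E; ring].
             apply lt_le. apply lt_le, le_ex in Hq. destruct Hq as [r Hr].
             apply le_ex. exists (r * (t + 1)). rewrite Hr. ring.
          -- right. exists b. split; [|ring]. apply lt_le.
             apply le_ex. exists (b * t). ring. }
  destruct (H n) as (b & N & K). exists b. split; [assumption|].
  intros d L. destruct (K d L) as [E|(q & _ & E)]; [now left|right]. now exists q.
Qed.

(** Divisibility with a bounded quotient, so that membership in a coded set is a bounded formula. *)
Definition coded x a b : Prop := exists q, q < a + 1 /\ a = modulus b x * q.

Lemma coded_dvd x a b : coded x a b <-> dvd (modulus b x) a.
Proof.
  split; [intros (q & _ & H); now exists q|].
  intros [q H]. exists q. split; [|assumption]. rewrite H. apply lt_le, le_ex.
  exists (b * (x + 1) * q). unfold modulus. ring.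
Qed.

Lemma coded_def f g h : defT f -> defT g -> defT h ->
  defD (fun e => coded (f e) (g e) (h e)).
Proof. intros. unfold coded, modulus. defd. Qed.

Ltac defd_step ::= apply coded_def; deft.

(** The code [a] is the product of the moduli of those [x < n] that satisfy [P]; Σ⁰₁ induction on
    [m] multiplies in the factors with [x < m]. *)
Lemma coding P n : def1 P -> exists a b, forall x, x < n -> (coded x a b <-> P x).
Proof.
  intros HP. destruct (common_multiple n) as (b & N & Hb).
  assert (H : forall m, exists a, forall x, x < n -> (coded x a b <-> x < m /\ P x)).
  { apply sigma1_ind.
    - apply (sig1_ex (fun a m => forall x, x < n -> (coded x a b <-> x < m /\ P x))). def.
    (* The empty product codes the empty set: as [b] is nonzero, every modulus exceeds 1 and does
       not divide 1. *)
    - exists 1. intros x _. rewrite coded_dvd. split.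
      + intros [q H]. exfalso. destruct (zero_or_succ q) as [->|[r ->]].
        { apply (succ_not_0 0). rewrite add_0_l, H. ring. }
        destruct (zero_or_succ b) as [->|[c ->]]; [easy|].
        apply (succ_not_0 (r + (c + 1) * (x + 1) * r + (c * x + c + x))).
        apply (add_cancel _ _ 1). transitivity (modulus (c + 1) x * (r + 1));
          [unfold modulus; ring | rewrite <- H; ring].
      + intros [L _]. now apply (lt_zero _ axioms) in L.
    - intros m (a & H). destruct (classic (m < n /\ P m)) as [[Lm Pm]|C].
      + exists (a * modulus b m). intros x Lx. rewrite coded_dvd.
        destruct (classic (x = m)) as [->|D].
        * split; [intros _; split; [apply lt_plus1|assumption]|].
          intros _. exists a. ring.
        * transitivity (coded x a b).
          -- rewrite coded_dvd. split; [|apply dvd_mul].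
             apply (modulus_prime b n); assumption.
          -- rewrite (H x Lx), lt_le. tauto.
      + exists a. intros x Lx. rewrite (H x Lx), lt_le. split; [tauto|].
        intros [[L| ->] Px]; tauto. }
  destruct (H n) as [a K]. exists a, b. intros x L. rewrite (K x L). tauto.
Qed.

(** * Course-of-values recursion and greedy sets *)

(** [F z P] says that [z] enters the set being built, given its part [P] below [z]. *)
Lemma set_recursion (F : num M -> (num M -> Prop) -> Prop) :
  (forall P Q z, (forall x, x < z -> (P x <-> Q x)) -> F z P -> F z Q) ->
  def3 (fun z a b => F z (fun x => coded x a b)) ->
  exists A, forall z, z ∈ A <-> F z (fun x => x ∈ A).
Proof.
  intros Floc Fdef.
  assert (Fiff : forall P Q z, (forall x, x < z -> (P x <-> Q x)) -> (F z P <-> F z Q)).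
  { intros P Q z H. split; apply Floc; [exact H|]. intros x L. symmetry. auto. }
  set (good := fun n a b => forall z, z < n ->
    (coded z a b <-> F z (fun x => coded x a b))).
  assert (Gdef : def3 good).
  { intros f g h Hf Hg Hh. unfold good. defd. }
  assert (Gex : forall n, exists a b, good n a b).
  { apply sigma1_ind.
    - apply (sig1_ex2 (fun a b n => good n a b)). intros f g h Hf Hg Hh.
      now apply Gdef.
    - exists 0, 0. intros z L. now apply (lt_zero _ axioms) in L.
    - intros n (a & b & H).
      (* A code is only controlled below the bound it was made for, so the old part and the decision
         on [n] are coded afresh. *)
      destruct (coding (fun z => (z < n /\ coded z a b) \/
        (z = n /\ F n (fun x => coded x a b))) (n + 1)) as (a' & b' & K); [def|].
      exists a', b'.
      assert (E : forall x, x < n -> (coded x a' b' <-> coded x a b)).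
      { intros x L. rewrite (K x); [|now apply lt_le; left]. split; [|tauto].
        intros [[_ C]|[-> _]]; [assumption|]. now apply lt_irrefl in L. }
      intros z L. apply lt_le in L. destruct L as [L| ->].
      + rewrite (E z L), (H z L). apply Fiff. intros x Lx. symmetry. apply E.
        eauto using lt_trans.
      + rewrite (K n); [|apply lt_plus1]. split.
        * intros [[L _]|[_ C]]; [now apply lt_irrefl in L|].
          revert C. apply Fiff, E.
        * intros C. right. split; [reflexivity|]. revert C. apply Fiff.
          intros x L. symmetry. now apply E. }
  assert (Guniq : forall n a b n' a' b', good n a b -> good n' a' b' ->
    forall z, z < n -> z < n' -> (coded z a b <-> coded z a' b')).
  { intros n a b n' a' b' G G' z0 L0 L0'. apply NNPP. intros N.
    destruct (least (fun z => z < n /\ z < n' /\ ~ (coded z a b <-> coded z a' b')) z0)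
      as (z & (L & L' & C) & K); [apply sig1_def; def|tauto|].
    apply C. rewrite (G z L), (G' z L'). apply Fiff. intros x Lx.
    apply NNPP. intros D. apply (K x Lx). eauto using lt_trans. }
  (* Good codes exist and agree with each other, so [z] is left out exactly when some good code
     omits it. Both membership and its negation are thus Σ⁰₁. *)
  destruct (delta1_comp (fun z => exists a b, good (z + 1) a b /\ coded z a b)) as [A HA].
  - apply (sig1_ex2 (fun a b z => good (z + 1) a b /\ coded z a b)).
    intros f g h Hf Hg Hh. apply defD_and; [apply Gdef; deft | defd].
  - destruct (sig1_ex2 (fun a b z => good (z + 1) a b /\ ~ coded z a b)) as (Q & HQ & H).
    { intros f g h Hf Hg Hh. apply defD_and; [apply Gdef; deft | defd]. }
    exists Q. split; [assumption|]. intros z. rewrite <- H. split.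
    + intros N. destruct (Gex (z + 1)) as (a & b & G). exists a, b.
      split; [assumption|]. intros C. apply N. eauto.
    + intros (a & b & G & N) (a' & b' & G' & C). apply N.
      apply (Guniq (z + 1) a b (z + 1) a' b'); auto using lt_plus1.
  - assert (HA' : forall n a b z, good n a b -> z < n -> (z ∈ A <-> coded z a b)).
    { intros n a b z G L. rewrite HA. split.
      - intros (a' & b' & G' & C).
        apply (Guniq n a b (z + 1) a' b'); auto using lt_plus1.
      - intros C. destruct (Gex (z + 1)) as (a' & b' & G'). exists a', b'.
        split; [assumption|]. apply (Guniq n a b (z + 1) a' b'); auto using lt_plus1. }
    exists A. intros z. destruct (Gex (z + 1)) as (a & b & G).
    rewrite (HA' _ a b z G (lt_plus1 z)), (G z (lt_plus1 z)). apply Fiff.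
    intros x L. symmetry. apply (HA' (z + 1)); [assumption|].
    eauto using lt_trans, lt_plus1.
Qed.

(** * Infinite sets: greedy subsets, chains and increasing enumerations *)

Lemma infinite_unbounded X : infinite M X <-> forall b, exists x, x ∈ X /\ b < x.
Proof.
  split.
  - intros H b. apply NNPP. intros N. apply H. exists (b + 1). intros x Hx.
    apply lt_le, not_lt. intros L. apply N. eauto.
  - intros H [b K]. destruct (H b) as (x & Hx & L).
    apply (lt_irrefl b). eauto using lt_trans.
Qed.

Lemma greedy_set Y (R : num M -> num M -> Prop) : def2 R ->
  exists A, forall z, z ∈ A <-> z ∈ Y /\ forall x, x < z -> x ∈ A -> R x z.
Proof.
  intros HR.
  destruct (set_recursion (fun z P => z ∈ Y /\ forall x, x < z -> P x -> R x z))
    as [A HA].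
  - intros P Q z H [Hz K]. split; [assumption|]. intros x L q.
    apply K; [assumption|]. now apply H.
  - def.
  - now exists A.
Qed.

(** The greedy set works. If it were bounded, its greatest element would have an [R]-successor in
    [Y] beyond the bound; by transitivity this point is compatible with all members, so it would
    have been put in. *)
Lemma infinite_chain Y (R : num M -> num M -> Prop) : def2 R -> infinite M Y ->
  (forall x y z, R x y -> R y z -> R x z) ->
  (forall y b, y ∈ Y -> exists z, z ∈ Y /\ b < z /\ R y z) ->
  exists A, subset M A Y /\ infinite M A /\
    forall x y, x ∈ A -> y ∈ A -> x < y -> R x y.
Proof.
  intros HR HY tr ext. destruct (greedy_set Y R HR) as [A HA].
  assert (AR : forall x y, x ∈ A -> y ∈ A -> x < y -> R x y).
  { intros x y Hx Hy L. apply HA in Hy. now apply Hy. }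
  exists A. split; [intros x Hx; now apply HA in Hx|]. split; [|assumption].
  intros [b Hb].
  assert (E : exists x, x ∈ A).
  { destruct (proj1 (infinite_unbounded Y) HY 0) as (y & Hy & _).
    destruct (least (fun x => x ∈ Y) y) as (x & Hx & K); [apply sig1_def; def|assumption|].
    exists x. apply HA. split; [assumption|]. intros w L Hw. elim (K w L).
    now apply HA in Hw. }
  destruct E as [x0 Hx0].
  destruct (greatest (fun x => x ∈ A) x0 b) as (x & Hx & K);
    [apply sig1_def; def|assumption|assumption|].
  assert (Hxy : x ∈ Y) by now apply HA in Hx.
  destruct (ext x b Hxy) as (z & Hz & L & Rz).
  apply (lt_irrefl b). apply (lt_trans _ z); [assumption|]. apply Hb, HA.
  split; [assumption|]. intros w Lw Hw.
  destruct (lt_total w x) as [C|[->|C]]; [|assumption|now elim (K w C)].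
  apply (tr w x z); [now apply AR|assumption].
Qed.

(** The graph is built by recursion on codes: [pair M (j + 1) x] enters when [pair M j y] is in and
    [y] is the predecessor of [x] in [Y]. The recursion is well founded because [pair_lt] makes the
    earlier code smaller. *)
Lemma increasing_enumeration Y : infinite M Y -> exists H, bijection_onto M H Y /\
  forall i j x y, pair M i x ∈ H -> pair M j y ∈ H -> (i < j <-> x < y).
Proof.
  intros HY.
  destruct (set_recursion (fun z P => exists i, i < z + 1 /\ exists x, x < z + 1 /\
    z = pair M i x /\ x ∈ Y /\
    ((i = 0 /\ forall w, w < x -> ~ w ∈ Y) \/
     (exists j, j < i /\ i = j + 1 /\ exists y, y < x /\
        P (pair M j y) /\ forall w, w < x -> y < w -> ~ w ∈ Y)))) as [H HH].
  { intros P Q z K (i & Hi & x & Hx & E & HxY & D). exists i. split; [assumption|].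
    exists x. do 3 (split; [assumption|]). destruct D as [D|(j & Hj & Ej & y & Hy & p & D)].
    - now left.
    - right. exists j. do 2 (split; [assumption|]). exists y. split; [assumption|]. split.
      + apply K; [|assumption]. rewrite E, Ej. apply pair_lt.
        apply (lt_trans _ (j + x)); apply lt_ex.
        * apply lt_ex in Hy. destruct Hy as [t ->]. exists t. ring.
        * exists 0. ring.
      + assumption. }
  { def. }
  assert (HP : forall i x, pair M i x ∈ H <-> x ∈ Y /\
    ((i = 0 /\ forall w, w < x -> ~ w ∈ Y) \/
     (exists j, i = j + 1 /\ exists y, y < x /\
        pair M j y ∈ H /\ forall w, w < x -> y < w -> ~ w ∈ Y))).
  { intros i x. rewrite HH. split.
    - intros (i' & _ & x' & _ & E & Hx & D). apply pair_inj in E. destruct E as [<- <-].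
      split; [assumption|]. destruct D as [D|(j & _ & D)]; eauto.
    - intros (Hx & D). exists i. split; [apply lt_le, pair_le|].
      exists x. split; [apply lt_le, pair_le|]. split; [reflexivity|].
      split; [assumption|]. destruct D as [D|(j & -> & D)]; [now left|right].
      exists j. split; [apply lt_plus1|]. auto. }
  assert (HY' : forall i x, pair M i x ∈ H -> x ∈ Y) by (intros i x K; now apply HP in K).
  assert (gap : forall x y z, y ∈ Y -> z ∈ Y -> y < x -> z < x ->
    (forall w, w < x -> y < w -> ~ w ∈ Y) ->
    (forall w, w < x -> z < w -> ~ w ∈ Y) -> y = z).
  { intros x y z Hy Hz Ly Lz Gy Gz. destruct (lt_total y z) as [L|[L|L]]; auto.
    - now elim (Gy z).
    - now elim (Gz y). }
  assert (fun1 : forall i x x', pair M i x ∈ H -> pair M i x' ∈ H -> x = x').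
  { intros i0 x0 x0' K0 K0'. apply NNPP. intros N0.
    destruct (least (fun i => exists x x', pair M i x ∈ H /\ pair M i x' ∈ H /\ x <> x') i0)
      as (i & (x & x' & K & K' & N) & C).
    - apply (sig1_ex2 (fun x x' i => pair M i x ∈ H /\ pair M i x' ∈ H /\ x <> x')). def.
    - eauto.
    - apply N. assert (Hx := HY' _ _ K). assert (Hx' := HY' _ _ K').
      apply HP in K, K'. destruct K as [_ [[-> D]|(j & -> & y & Ly & Hy & D)]].
      + destruct K' as [_ [[_ D']|(j & E & _)]]; [|now elim (succ_not_0 j)].
        destruct (lt_total x x') as [L|[L|L]]; auto.
        * now elim (D' x).
        * now elim (D x').
      + destruct K' as [_ [[E _]|(j' & E & y' & Ly' & Hy' & D')]];
          [now elim (succ_not_0 j)|].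
        apply (succ_inj _ axioms) in E. subst j'.
        assert (y = y') as <-.
        { apply NNPP. intros Ny. apply (C j); [apply lt_plus1|]. eauto. }
        destruct (lt_total x x') as [L|[L|L]]; auto.
        * now elim (D' x).
        * now elim (D x'). }
  assert (tot : forall i, exists x, pair M i x ∈ H).
  { apply sigma1_ind.
    - apply (sig1_ex (fun x i => pair M i x ∈ H)). def.
    - destruct (proj1 (infinite_unbounded Y) HY 0) as (y & Hy & _).
      destruct (least (fun x => x ∈ Y) y) as (x & Hx & K);
        [apply sig1_def; def|assumption|].
      exists x. apply HP. auto.
    - intros i (y & Hy). destruct (proj1 (infinite_unbounded Y) HY y) as (z & Hz).
      destruct (least (fun x => x ∈ Y /\ y < x) z) as (x & (Hx & L) & K);
        [apply sig1_def; def|assumption|].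
      exists x. apply HP. split; [assumption|right]. exists i. split; [reflexivity|].
      exists y. do 2 (split; [assumption|]). intros w Lw Lyw Hw. now apply (K w Lw). }
  (* The bound on the index makes failure a bounded formula, so that a least counterexample
     exists. *)
  assert (onto : forall x, x ∈ Y -> exists i, i < x + 1 /\ pair M i x ∈ H).
  { intros x0 Hx0. apply NNPP. intros N0.
    destruct (least (fun x => x ∈ Y /\ ~ exists i, i < x + 1 /\ pair M i x ∈ H) x0)
      as (x & (Hx & N) & C); [apply sig1_def; def|tauto|].
    apply N. destruct (classic (exists y, y < x /\ y ∈ Y)) as [(y0 & L0 & Hy0)|D].
    - destruct (greatest (fun y => y < x /\ y ∈ Y) y0 x) as (y & (L & Hy) & G);
        [apply sig1_def; def|tauto|tauto|].
      assert (K : exists i, i < y + 1 /\ pair M i y ∈ H)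
        by (apply NNPP; intros K; apply (C y); tauto).
      destruct K as (i & Li & Hi). exists (i + 1). split.
      + apply lt_le, succ_le. apply lt_le in Li. eauto using le_lt_trans.
      + apply HP. split; [assumption|right]. exists i. split; [reflexivity|].
        exists y. do 2 (split; [assumption|]). intros w Lw Lyw Hw. now apply (G w Lyw).
    - exists 0. split; [apply lt_le, zero_le|]. apply HP. split; [assumption|left].
      split; [reflexivity|]. intros w Lw Hw. apply D. eauto. }
  assert (mono : forall i j x y, pair M i x ∈ H -> pair M j y ∈ H -> i < j -> x < y).
  { intros i j x y Hx Hy L.
    (* The value at [j] is quantified existentially to keep the induction Σ⁰₁; [fun1] identifies it
       with [y] afterwards. *)
    assert (K : forall j, exists y, pair M j y ∈ H /\ (i < j -> x < y)).
    { apply sigma1_ind.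
      - apply (sig1_ex (fun y j => pair M j y ∈ H /\ (i < j -> x < y))). def.
      - destruct (tot 0) as [w Hw]. exists w. split; [assumption|].
        intros C. now apply (lt_zero _ axioms) in C.
      - intros k (w & Hw & IH). destruct (tot (k + 1)) as [v Hv]. exists v.
        split; [assumption|]. intros C. apply HP in Hv.
        destruct Hv as [_ [[E _]|(k' & E & v' & Lv & Hv' & _)]]; [now elim (succ_not_0 k)|].
        apply (succ_inj _ axioms) in E. subst k'. apply (fun1 _ _ _ Hw) in Hv'. subst v'.
        apply lt_le in C. destruct C as [C| ->]; [eauto using lt_trans|].
        now rewrite (fun1 _ _ _ Hx Hw). }
    destruct (K j) as (w & Hw & IH). rewrite (fun1 _ _ _ Hy Hw). auto. }
  exists H. split.
  - split; [|split].
    + intros z Hz. apply HH in Hz. destruct Hz as (i & _ & x & _ & E & Hx & _). eauto.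
    + intros i. destruct (tot i) as [x Hx]. exists x. split; [assumption|].
      intros x' Hx'. eauto.
    + intros x Hx. destruct (onto x Hx) as (i & _ & Hi). exists i. split; [assumption|].
      intros i' Hi'. destruct (lt_total i i') as [L|[L|L]]; auto;
        exfalso; apply (lt_irrefl x); eauto.
  - intros i j x y Hi Hj. split; [now apply mono|]. intros L.
    destruct (lt_total i j) as [K|[->|K]]; [assumption| |].
    + rewrite (fun1 _ _ _ Hi Hj) in L. now apply lt_irrefl in L.
    + exfalso. apply (lt_irrefl x). eauto using lt_trans.
Qed.

(** * Spaces and subspaces *)

Implicit Types S T : space M.

Lemma basic_set S n : exists B, forall x, x ∈ B <-> inU M S x n.
Proof. unfold inU. apply (def_comp (fun x => pair M x n ∈ base M S)). def. Qed.

(** The relation ⟨y, x⟩ ∈ cl, that is, [y] lies in the closure of {x}, with indices in place of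
    basic sets. *)
Definition closes S y x : Prop := forall n, inU M S y n -> inU M S x n.

Lemma closes_basic S y x :
  closes S y x <-> forall B, basic M S B -> y ∈ B -> x ∈ B.
Proof.
  split.
  - intros H B [n HB] Hy. apply HB, H, HB, Hy.
  - intros H n Hy. destruct (basic_set S n) as [B HB]. apply HB, H, HB, Hy.
    exists n. exact HB.
Qed.

Lemma not_closes S y x : ~ closes S y x -> exists n, inU M S y n /\ ~ inU M S x n.
Proof.
  intros H. apply NNPP. intros N. apply H. intros n Hy. apply NNPP. intros Hx.
  apply N. eauto.
Qed.

Lemma T1_closes S :
  T1_space M S <-> forall x y, x ∈ pts M S -> y ∈ pts M S -> x <> y -> ~ closes S x y.
Proof.
  split.
  - intros H x y Hx Hy N C. destruct (H x y Hx Hy N) as (A & B & HA & _ & [K L] & [_ K']).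
    rewrite closes_basic in C. apply K', (C A HA K).
  - intros H x y Hx Hy N. destruct (not_closes S x y) as (n & K & K'); [auto|].
    destruct (not_closes S y x) as (m & L & L'); [auto|].
    destruct (basic_set S n) as [A HA]. destruct (basic_set S m) as [B HB].
    exists A, B. rewrite !HA, !HB. split; [now exists n|]. split; [now exists m|]. tauto.
Qed.

Lemma open_set_iff S A : open_set M S A <-> subset M A (pts M S) /\
  forall x, x ∈ A -> exists n, inU M S x n /\ forall y, inU M S y n -> y ∈ A.
Proof.
  split; intros [HA K]; (split; [assumption|]); intros x Hx.
  - destruct (K x Hx) as (B & [n HB] & HxB & HBA). exists n. rewrite <- HB.
    split; [assumption|]. intros y Hy. apply HBA, HB, Hy.
  - destruct (K x Hx) as (n & Hn & HA'). destruct (basic_set S n) as [B HB].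
    exists B. split; [now exists n|]. split; [now apply HB|]. intros y Hy. apply HA', HB, Hy.
Qed.

Lemma inU_pts S x n : is_csc M S -> inU M S x n -> x ∈ pts M S.
Proof.
  intros (H & _) K. destruct (H _ K) as (y & m & Hy & E).
  apply pair_inj in E. now destruct E as [-> _].
Qed.

Lemma kcode_inj x m n v x' m' n' v' :
  kcode M x m n v = kcode M x' m' n' v' -> x = x' /\ m = m' /\ n = n' /\ v = v'.
Proof.
  unfold kcode. intros E. apply pair_inj in E. destruct E as [E ->].
  apply pair_inj in E. destruct E as [E ->]. apply pair_inj in E. tauto.
Qed.

Lemma kcode_bound x m n v : x <= kcode M x m n v /\ m <= kcode M x m n v /\
  n <= kcode M x m n v /\ v <= kcode M x m n v.
Proof.
  unfold kcode. destruct (pair_le (pair M (pair M x m) n) v) as [H1 Hv].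
  destruct (pair_le (pair M x m) n) as [H2 Hn]. destruct (pair_le x m) as [Hx Hm].
  split; [exact (le_trans _ _ _ Hx (le_trans _ _ _ H2 H1))|].
  split; [exact (le_trans _ _ _ Hm (le_trans _ _ _ H2 H1))|].
  split; [exact (le_trans _ _ _ Hn H1)|exact Hv].
Qed.

Lemma inU_sub T S x n : is_subspace M T S ->
  (inU M T x n <-> x ∈ pts M T /\ inU M S x n).
Proof.
  intros (_ & H & _). unfold inU. rewrite H. split.
  - intros (K & y & m & Hy & E). apply pair_inj in E. destruct E as [-> _]. tauto.
  - intros (Hx & K). eauto.
Qed.

Lemma closes_sub T S x y : is_subspace M T S -> x ∈ pts M T -> y ∈ pts M T ->
  (closes T x y <-> closes S x y).
Proof.
  intros HT Hx Hy. unfold closes. split; intros H n; specialize (H n).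
  - rewrite !(inU_sub T S _ n HT) in H. tauto.
  - rewrite !(inU_sub T S _ n HT). tauto.
Qed.

Lemma subspace_exists S A : subset M A (pts M S) ->
  exists T, is_subspace M T S /\ pts M T = A.
Proof.
  intros HA.
  destruct (def_comp (fun z => z ∈ base M S /\ exists x, x < z + 1 /\ exists n, n < z + 1 /\
    x ∈ A /\ z = pair M x n)) as [B HB]; [def|].
  destruct (def_comp (fun z => z ∈ kfun M S /\ exists x, x < z + 1 /\ exists m, m < z + 1 /\
    exists n, n < z + 1 /\ exists v, v < z + 1 /\ x ∈ A /\ z = kcode M x m n v)) as [K HK].
  { unfold kcode. def. }
  exists {| pts := A; base := B; kfun := K |}. split; [|reflexivity].
  split; [exact HA|]. split; cbn.
  - intros z. rewrite HB. split.
    + intros (Hz & x & _ & n & _ & H). eauto.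
    + intros (Hz & x & n & Hx & ->). split; [assumption|].
      exists x. split; [apply lt_le, pair_le|]. exists n. split; [apply lt_le, pair_le|]. auto.
  - intros z. rewrite HK. split.
    + intros (Hz & x & _ & m & _ & n & _ & v & _ & H). split; [assumption|]. exists x, m, n, v.
      assumption.
    + intros (Hz & x & m & n & v & Hx & ->). split; [assumption|].
      destruct (kcode_bound x m n v) as (Bx & Bm & Bn & Bv).
      exists x. split; [now apply lt_le|]. exists m. split; [now apply lt_le|].
      exists n. split; [now apply lt_le|]. exists v. split; [now apply lt_le|]. auto.
Qed.

Lemma subspace_csc T S : is_subspace M T S -> is_csc M S -> is_csc M T.
Proof.
  intros HT (_ & S2 & _ & S4 & S5). assert (HT' := HT).
  destruct HT' as (Hpts & Hbase & Hk).
  assert (Ek : forall x m n v, kcode M x m n v ∈ kfun M T <->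
    x ∈ pts M T /\ kcode M x m n v ∈ kfun M S).
  { intros x m n v. rewrite Hk. split.
    - intros (K & x' & m' & n' & v' & Hx & E). apply kcode_inj in E.
      destruct E as (-> & _). tauto.
    - intros (Hx & K). split; [assumption|]. exists x, m, n, v. auto. }
  split; [|split; [|split; [|split]]].
  - intros z Hz. now apply Hbase in Hz.
  - intros x Hx. destruct (S2 x (Hpts x Hx)) as [n Hn]. exists n.
    apply (inU_sub T S _ _ HT). auto.
  - intros z Hz. now apply Hk in Hz.
  - intros x m n Hx. destruct (S4 x m n (Hpts x Hx)) as (v & Hv & U). exists v.
    split; [now apply Ek|]. intros v' Hv'. apply U. now apply Ek in Hv'.
  - intros x m n v Hm Hn Hv. apply Ek in Hv.
    apply (inU_sub T S _ _ HT) in Hm, Hn. rewrite (inU_sub T S _ _ HT).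
    destruct (S5 x m n v) as [K L]; try tauto. split; [tauto|].
    intros y. rewrite !(inU_sub T S _ _ HT). intros [Hy Uy]. apply L in Uy. tauto.
Qed.

Lemma subspace_trans R S T : is_subspace M R S -> is_subspace M S T -> is_subspace M R T.
Proof.
  intros (P1 & B1 & K1) (P2 & B2 & K2). split; [|split].
  - intros x Hx. auto.
  - intros z. rewrite B1, B2. split; [tauto|]. intros (Hz & x & n & Hx & E).
    repeat split; eauto.
  - intros z. rewrite K1, K2. split; [tauto|]. intros (Hz & x & m & n & v & Hx & E).
    repeat split; auto; exists x, m, n, v; auto.
Qed.

Lemma subspace_T1 T S : is_subspace M T S -> T1_space M S -> T1_space M T.
Proof.
  intros HT. rewrite !T1_closes. intros H x y Hx Hy N.
  rewrite (closes_sub T S x y HT Hx Hy). apply H; [apply HT; assumption..|assumption].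
Qed.

Lemma inU_open S n : is_csc M S -> exists B, open_set M S B /\ forall x, x ∈ B <-> inU M S x n.
Proof.
  intros HS. destruct (basic_set S n) as [B HB]. exists B. split; [|assumption].
  apply open_set_iff. split.
  - intros x Hx. apply HB in Hx. now apply (inU_pts S x n).
  - intros x Hx. exists n. rewrite <- HB. split; [assumption|].
    intros y. apply HB.
Qed.

(** Each of the first three topologies has a point that cannot be separated from another: any point
    in the indiscrete case, h(1) from h(0) for initial segments, and h(0) from h(1) for final
    segments. *)
Lemma T1_alternatives T : is_csc M T -> T1_space M T -> infinite M (pts M T) ->
  indiscrete M T \/ initial_segment_topology M T \/ final_segment_topology M T \/
    discrete M T \/ cofinite_topology M T ->
  discrete M T \/ cofinite_topology M T.
Proof.
  intros HT HT1 Hinf. rewrite T1_closes in HT1.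
  assert (sep : forall x y, x ∈ pts M T -> y ∈ pts M T -> x <> y ->
    exists B, open_set M T B /\ basic M T B /\ x ∈ B /\ ~ y ∈ B).
  { intros x y Hx Hy N. destruct (not_closes T x y (HT1 x y Hx Hy N)) as (n & K & L).
    destruct (inU_open T n HT) as (B & OB & HB). exists B. rewrite !HB.
    repeat split; auto; try apply OB. now exists n. }
  assert (lift : forall H x y, pair M 0 x ∈ H -> pair M (0 + 1) y ∈ H ->
    bijection_onto M H (pts M T) -> x ∈ pts M T /\ y ∈ pts M T /\ x <> y).
  { intros H x y Hx Hy (B1 & _ & B3).
    assert (B : forall i z, pair M i z ∈ H -> z ∈ pts M T).
    { intros i z Hz. destruct (B1 _ Hz) as (i' & z' & Hz' & E).
      apply pair_inj in E. now destruct E as [_ ->]. }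
    repeat split; [eauto..|]. intros <-.
    destruct (B3 x) as (i & _ & U); [eauto|].
    apply (succ_not_0 0). transitivity i; [symmetry|]; now apply U. }
  intros [H|[H|[H|H]]]; [exfalso..|assumption].
  - destruct (proj1 (infinite_unbounded _) Hinf 0) as (x & Hx & _).
    destruct (proj1 (infinite_unbounded _) Hinf x) as (y & Hy & L).
    destruct (sep x y Hx Hy) as (B & _ & BB & Bx & By).
    + intros ->. now apply lt_irrefl in L.
    + destruct (H B BB) as [K|K]; [now apply (K x)|now apply By, K].
  - destruct H as (_ & H & HB & HO). destruct HB as (B1 & B2 & B3).
    destruct (B2 0) as (x & Hx & _). destruct (B2 (0 + 1)) as (y & Hy & _).
    destruct (lift H x y Hx Hy) as (Px & Py & N); [now split|].
    destruct (sep y x Py Px (not_eq_sym N)) as (B & OB & _ & By & Bx).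
    apply HO in OB. destruct OB as [K|[K|[j K]]].
    + now apply (K y).
    + now apply Bx, K.
    + apply Bx, K. exists 0. split; [apply zero_le|assumption].
  - destruct H as (_ & H & HB & HO). destruct HB as (B1 & B2 & B3).
    destruct (B2 0) as (x & Hx & _). destruct (B2 (0 + 1)) as (y & Hy & _).
    destruct (lift H x y Hx Hy) as (Px & Py & N); [now split|].
    destruct (sep x y Px Py N) as (B & OB & _ & Bx & By).
    apply HO in OB. destruct OB as [K|[K|[j K]]].
    + now apply (K x).
    + now apply By, K.
    (* The segment contains [x], whose only index is 0, so it starts at 0 and contains [y] too. *)
    + apply By, K. exists (0 + 1). split; [|assumption].
      apply K in Bx. destruct Bx as (i & L & Hi).
      destruct (B3 x Px) as (i' & _ & U). rewrite <- (U _ Hi), (U _ Hx) in L.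
      apply (le_trans _ 0); [assumption|apply zero_le].
Qed.

(** * A dichotomy for transitive relations *)

Lemma transitive_dichotomy X (Q : num M -> num M -> Prop) :
  GST1 M -> infinite M X -> def2 Q -> (forall x y z, Q x y -> Q y z -> Q x z) ->
  exists Y, subset M Y X /\ infinite M Y /\
    ((forall y, y ∈ Y -> exists b, forall z, z ∈ Y -> Q y z -> z < b) \/
     (forall y, y ∈ Y -> exists b, forall z, z ∈ Y -> b < z -> Q y z)).
Proof.
  intros G HX HQ tr.
  (* The basic set with centre [x] and cut-off [b] receives the index [pair M x b]; indices of
     another form, or with a centre outside [X], give the empty set. *)
  destruct (def_comp (fun z => exists y, y < z + 1 /\ exists n, n < z + 1 /\
    z = pair M y n /\ y ∈ X /\ exists x, x < n + 1 /\ exists b, b < n + 1 /\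
    n = pair M x b /\ x ∈ X /\ (y = x \/ (Q x y /\ b < y)))) as [B HB]; [def|].
  (* The function k returns the basic set with centre [x] and cut-off [m + n]. A cut-off is at most
     the index it occurs in, so [m + n] dominates the cut-offs of both given sets, and transitivity
     puts the cone of [x] inside theirs. *)
  destruct (def_comp (fun z => exists x, x < z + 1 /\ exists m, m < z + 1 /\
    exists n, n < z + 1 /\ x ∈ X /\ z = kcode M x m n (pair M x (m + n)))) as [K HK].
  { unfold kcode. def. }
  set (S := {| pts := X; base := B; kfun := K |}).
  assert (US : forall y n, inU M S y n <-> y ∈ X /\ exists x b, n = pair M x b /\ x ∈ X /\
    (y = x \/ (Q x y /\ b < y))).
  { intros y n. unfold inU. cbn. rewrite HB. split.
    - intros (y' & _ & n' & _ & E & Hy & x & _ & b & _ & H).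
      apply pair_inj in E. destruct E as [-> ->]. eauto.
    - intros (Hy & x & b & -> & H). exists y. split; [apply lt_le, pair_le|].
      exists (pair M x b). split; [apply lt_le, pair_le|].
      do 2 (split; [easy|]). exists x. split; [apply lt_le, pair_le|].
      exists b. split; [apply lt_le, pair_le|]. auto. }
  assert (KS : forall x m n v, kcode M x m n v ∈ K <-> x ∈ X /\ v = pair M x (m + n)).
  { intros x m n v. rewrite HK. split.
    - intros (x' & _ & m' & _ & n' & _ & Hx & E). apply kcode_inj in E.
      destruct E as (-> & -> & -> & ->). auto.
    - intros (Hx & ->). destruct (kcode_bound x m n (pair M x (m + n))) as (Bx & Bm & Bn & _).
      exists x. split; [now apply lt_le|]. exists m. split; [now apply lt_le|].
      exists n. split; [now apply lt_le|]. auto. }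
  assert (cone : forall x m n y, inU M S x m -> m <= n -> inU M S y (pair M x n) -> inU M S y m).
  { intros x m n y Hx L Hy. apply US in Hx, Hy. apply US.
    destruct Hx as (Hx & a & b & Em & Ha & Dx). destruct Hy as (Hy & a' & b' & E & _ & Dy).
    apply pair_inj in E. destruct E as [<- <-]. split; [assumption|].
    exists a, b. do 2 (split; [assumption|]).
    assert (Lb : b <= n) by (apply (le_trans _ m); [rewrite Em; apply pair_le|assumption]).
    destruct Dy as [->|[Qy Ly]]; [assumption|]. right.
    split; [|eauto using le_lt_trans]. destruct Dx as [<-|[Qx _]]; eauto. }
  assert (CS : is_csc M S).
  { split; [|split; [|split; [|split]]].
    - intros z Hz. cbn in Hz. apply HB in Hz. destruct Hz as (y & _ & n & _ & E & Hy & _).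
      exists y, n. auto.
    - intros x Hx. exists (pair M x 0). apply US. split; [assumption|]. exists x, 0. auto.
    - intros z Hz. cbn in Hz. apply HK in Hz.
      destruct Hz as (x & _ & m & _ & n & _ & Hx & E). exists x, m, n, (pair M x (m + n)). auto.
    - intros x m n Hx. exists (pair M x (m + n)). cbn. split; [now apply KS|].
      intros v Hv. apply KS in Hv. now destruct Hv as [_ ->].
    - intros x m n v Hm Hn Hv. cbn in Hv. apply KS in Hv. destruct Hv as [Hx ->]. split.
      + apply US. split; [assumption|]. exists x, (m + n). auto.
      + intros y Hy. split.
        * apply (cone x m (m + n)); auto using le_add_r.
        * apply (cone x n (m + n)); auto using le_add_l. }
  assert (T1 : T1_space M S).
  { apply T1_closes. intros x y Hx Hy N C.
    (* With cut-off [y], the basic set centred at [x] misses [y]. *)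
    assert (Ux : inU M S x (pair M x y)) by (apply US; split; [assumption|]; exists x, y; auto).
    apply C, US in Ux. destruct Ux as (_ & a & b & E & _ & D). apply pair_inj in E.
    destruct E as [<- <-]. destruct D as [D|[_ D]]; [now apply N|now apply lt_irrefl in D]. }
  destruct (G S CS HX T1) as (T & HT & Tinf & D).
  apply T1_alternatives in D;
    [|now apply (subspace_csc T S)|now apply (subspace_T1 T S)|assumption].
  assert (TX : subset M (pts M T) X) by apply HT.
  exists (pts M T). split; [assumption|]. split; [assumption|].
  destruct D as [D|[_ D]]; [left|right]; intros y Hy.
  (* A basic set isolating [y] in the subspace would, by transitivity, also contain every [z] there
     with [Q y z] beyond its cut-off. Such [z] are therefore bounded. *)
  - destruct (D y Hy) as (A & [n HA] & HAy).
    assert (Uy : inU M T y n) by now apply HA, HAy.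
    assert (uniq : forall z, inU M T z n -> z = y) by (intros z Hz; now apply HAy, HA).
    rewrite (inU_sub T S _ _ HT), US in Uy. destruct Uy as (_ & _ & x & b & En & Hx & Dy).
    destruct (upper_bound b y) as (c & Lb & Ly). exists c. intros z Hz Qz. apply NNPP.
    intros N. apply not_lt in N. assert (z = y) as ->;
      [|now apply (lt_irrefl y); eauto using lt_le_trans].
    apply uniq. apply (inU_sub T S _ _ HT). split; [assumption|]. apply US.
    split; [auto|]. exists x, b. do 2 (split; [assumption|]). right.
    split; [|eauto using lt_le_trans]. destruct Dy as [<-|[Qy _]]; eauto.
  (* The basic set centred at [y] with cut-off 0 is open and nonempty, hence cofinite, and apart
     from [y] it lies in the cone of [y]. *)
  - destruct (inU_open T (pair M y 0)) as (A & OA & HA); [now apply (subspace_csc T S)|].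
    apply D in OA; [|apply OA]. destruct OA as [OA|[b OA]].
    + exfalso. apply (OA y), HA, (inU_sub T S _ _ HT). split; [assumption|].
      apply US. split; [auto|]. exists y, 0. auto.
    + destruct (upper_bound b y) as (c & Lb & Ly). exists c. intros z Hz L.
      assert (Az : z ∈ A).
      { apply NNPP. intros N. apply (lt_irrefl b). apply (lt_trans _ c); [assumption|].
        eauto using lt_trans. }
      apply HA, (inU_sub T S _ _ HT) in Az. destruct Az as [_ Az]. apply US in Az.
      destruct Az as (_ & x & b' & E & _ & Dz). apply pair_inj in E. destruct E as [<- _].
      destruct Dz as [->|[Qz _]]; [|assumption]. exfalso.
      apply (lt_irrefl y). eauto using lt_trans.
Qed.

(** With [f z] the least [u] such that [C u z], the dichotomy is applied to the
    preorder [f z <= f w]. *)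
Lemma pigeonhole X (C : num M -> num M -> Prop) b :
  GST1 M -> infinite M X -> def2 C ->
  (forall z, z ∈ X -> exists u, u < b /\ C u z) ->
  exists u, u < b /\ forall a, exists z, z ∈ X /\ a < z /\ C u z.
Proof.
  intros G HX HC tot.
  destruct (transitive_dichotomy X
    (* This says [f z <= f w] by a bounded formula, without naming the least witnesses. *)
    (fun z w => forall u, u < b -> C u w -> exists v, v < u + 1 /\ C v z))
    as (Y & YX & HY & D); try assumption.
  - def.
  - intros x y z K L u Hu Hz. destruct (L u Hu Hz) as (v & Lv & Hv).
    apply lt_le in Lv. destruct (K v) as (w & Lw & Hw); [eauto using le_lt_trans|assumption|].
    exists w. split; [|assumption]. apply lt_le. apply lt_le in Lw. eauto using le_trans.
  - destruct (proj1 (infinite_unbounded Y) HY 0) as (y0 & Hy0 & _).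
    destruct D as [D|D].
    (* A [z] in [Y] with least value of [f] is related to all of [Y], so its cone cannot be
       bounded. *)
    + exfalso. destruct (tot y0 (YX _ Hy0)) as (u0 & _ & Hu0).
      destruct (least (fun u => exists z, z ∈ Y /\ C u z) u0) as (u & (z & Hz & Hu) & min).
      { apply (sig1_ex (fun z u => z ∈ Y /\ C u z)). def. }
      { eauto. }
      apply HY. destruct (D z Hz) as (c & Hc). exists c. intros w Hw. apply Hc; [assumption|].
      intros v _ Hv. exists u. split; [|assumption]. apply lt_le, not_lt. intros L.
      apply (min v L). eauto.
    + assert (bound : forall u, (exists z, z ∈ Y /\ forall v, v < u -> ~ C v z) -> u < b + 1).
      { intros u (z & Hz & K). apply lt_le, not_lt. intros L.
        destruct (tot z (YX _ Hz)) as (v & Lv & Hv). apply (K v); eauto using lt_trans. }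
      (* The predicate says that [f] reaches at least [u] on [Y], so [u] becomes the maximum of [f].
         The cone of a point attaining it contains a tail of [Y], and there [f] is constantly
         [u]. *)
      destruct (greatest (fun u => exists z, z ∈ Y /\ forall v, v < u -> ~ C v z) 0 (b + 1))
        as (u & (z & Hz & Hu) & max).
      { apply (sig1_ex (fun z u => z ∈ Y /\ forall v, v < u -> ~ C v z)). def. }
      { exists y0. split; [assumption|]. intros v L. now apply (lt_zero _ axioms) in L. }
      { assumption. }
      destruct (D z Hz) as (c & Hc).
      assert (fiber : forall w, w ∈ Y -> c < w -> C u w /\ u < b).
      { intros w Hw L. specialize (Hc w Hw L).
        destruct (tot w (YX _ Hw)) as (v0 & Lv0 & Hv0).
        destruct (least (fun v => v < b /\ C v w) v0) as (v & (Lv & Hv) & min);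
          [apply sig1_def; def|auto|].
        assert (E : u = v).
        { destruct (lt_total u v) as [K|[K|K]]; [|assumption|]; exfalso.
          - apply (max v K). exists w. split; [assumption|]. intros t Lt Ht.
            apply (min t Lt). split; [eauto using lt_trans|assumption].
          - destruct (Hc v Lv Hv) as (t & Lt & Ht). apply (Hu t); [|assumption].
            apply lt_le in Lt. eauto using le_lt_trans. }
        rewrite E. auto. }
      exists u. split.
      * destruct (proj1 (infinite_unbounded Y) HY c) as (w & Hw & L). now apply (fiber w).
      * intros a. destruct (upper_bound a c) as (d & La & Lc).
        destruct (proj1 (infinite_unbounded Y) HY d) as (w & Hw & L). exists w.
        split; [auto|]. split; [eauto using lt_trans|].
        apply fiber; eauto using lt_trans.
Qed.

(** * Chains and antichains of a transitive relation *)

Lemma preorder_chain Y (R : num M -> num M -> Prop) : def2 R -> infinite M Y ->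
  (forall x y z, R x y -> R y z -> R x z) ->
  (forall y, y ∈ Y -> exists b, forall z, z ∈ Y -> b < z -> R y z) ->
  exists A, subset M A Y /\ infinite M A /\
    ((forall x y, x ∈ A -> y ∈ A -> x <> y -> R x y) \/
     (forall x y, x ∈ A -> y ∈ A -> x < y -> R x y /\ ~ R y x)).
Proof.
  intros HR HY tr cof.
  destruct (infinite_chain Y R HR HY tr) as (A & AY & HA & AR).
  { intros y b Hy. destruct (cof y Hy) as (c & Hc). destruct (upper_bound b c) as (d & Lb & Lc).
    destruct (proj1 (infinite_unbounded Y) HY d) as (z & Hz & L). exists z.
    split; [assumption|]. split; [eauto using lt_trans|]. apply Hc; eauto using lt_trans. }
  (* If all later members are [R]-below some [y], the members beyond [y] are pairwise equivalent.
     Otherwise every member is followed by one that is not [R]-below it, and [A] thins out to a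
     strict chain. *)
  destruct (classic (exists y, y ∈ A /\ forall z, z ∈ A -> y < z -> R z y)) as [(y & Hy & K)|N].
  - destruct (def_comp (fun z => z ∈ A /\ y < z)) as [B HB]; [def|].
    exists B. split; [intros x Hx; apply AY; now apply HB in Hx|]. split.
    + apply infinite_unbounded. intros b. destruct (upper_bound b y) as (d & Lb & Ly).
      destruct (proj1 (infinite_unbounded A) HA d) as (z & Hz & L). exists z.
      split; [apply HB|]; eauto using lt_trans.
    + left. intros x z Hx Hz _. apply HB in Hx, Hz. destruct Hx as [Hx Lx].
      destruct Hz as [Hz Lz]. apply (tr x y z); [now apply K|now apply AR].
  - destruct (infinite_chain A (fun x y => R x y /\ ~ R y x)) as (B & BA & HB & BR).
    + def.
    + assumption.
    + intros x y z [K K'] [L L']. split; [eauto|]. intros C. apply K'. eauto.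
    + intros y b Hy. destruct (upper_bound b y) as (d & Lb & Ly).
      (* Going through a member [w] beyond both [y] and [b] yields [z > b] with [R z w] false; then
         [R z y] is false too, as it would give [R z w] by way of [R y w]. *)
      destruct (proj1 (infinite_unbounded A) HA d) as (w & Hw & L).
      apply NNPP. intros C. apply N. exists w. split; [assumption|].
      intros z Hz Lz. apply NNPP. intros NR. apply C.
      assert (Lyw : y < w) by eauto using lt_trans.
      assert (Lbw : b < w) by eauto using lt_trans.
      exists z. split; [assumption|]. split; [eauto using lt_trans|].
      split; [apply AR; eauto using lt_trans|]. intros Rzy. apply NR. eauto.
    + exists B. split; [intros x Hx; auto|]. split; [assumption|]. now right.
Qed.

Lemma preorder_subset X (R : num M -> num M -> Prop) :
  GST1 M -> infinite M X -> def2 R -> (forall x y z, R x y -> R y z -> R x z) ->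
  exists A, subset M A X /\ infinite M A /\
    ((forall x y, x ∈ A -> y ∈ A -> x <> y -> R x y) \/
     (forall x y, x ∈ A -> y ∈ A -> x < y -> R x y /\ ~ R y x) \/
     (forall x y, x ∈ A -> y ∈ A -> x < y -> R y x /\ ~ R x y) \/
     (forall x y, x ∈ A -> y ∈ A -> x <> y -> ~ R x y)).
Proof.
  intros G HX HR tr.
  assert (HR' : def2 (fun x y => R y x)) by def.
  assert (tr' : forall x y z, R y x -> R z y -> R z x) by eauto.
  destruct (transitive_dichotomy X R) as (Y & YX & HY & [DY|DY]); try assumption; cycle 1.
  { destruct (preorder_chain Y R) as (A & AY & HA & D); try assumption.
    exists A. split; [intros x Hx; auto|]. split; [assumption|]. tauto. }
  destruct (transitive_dichotomy Y (fun x y => R y x)) as (Z & ZY & HZ & [DZ|DZ]);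
    try assumption; cycle 1.
  { destruct (preorder_chain Z (fun x y => R y x)) as (A & AZ & HA & D); try assumption.
    exists A. split; [intros x Hx; auto|]. split; [assumption|].
    destruct D as [D|D]; [left|now do 2 right; left]. intros x y Hx Hy N. apply D; auto. }
  (* By now each point of [Z] has boundedly many [R]-successors and [R]-predecessors in [Z]. *)
  destruct (greedy_set Z (fun x y => ~ R x y /\ ~ R y x)) as (A & HA); [def|].
  assert (AZ : subset M A Z) by (intros x Hx; now apply HA in Hx).
  exists A. split; [intros x Hx; auto|]. split.
  - intros [b Hb].
    (* If the antichain lay below [b], each point of [Z] beyond [b] would have been rejected, hence
       be comparable to a member [u < b]. The pigeonhole principle makes one [u] comparable to
       unboundedly many points, against the bounds on its two cones. *)
    destruct (def_comp (fun z => z ∈ Z /\ b < z)) as [Z' HZ']; [def|].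
    destruct (pigeonhole Z' (fun u z => u ∈ A /\ (R u z \/ R z u)) b) as (u & Lu & K);
      try assumption.
    + apply infinite_unbounded. intros c. destruct (upper_bound b c) as (d & Lb & Lc).
      destruct (proj1 (infinite_unbounded Z) HZ d) as (z & Hz & L). exists z.
      split; [apply HZ'|]; eauto using lt_trans.
    + def.
    + intros z Hz. apply HZ' in Hz. destruct Hz as [Hz Lz]. apply NNPP. intros N.
      apply (lt_irrefl b). apply (lt_trans _ z); [assumption|]. apply Hb, HA.
      split; [assumption|]. intros x _ Hx. specialize (Hb x Hx). split; intros C; eauto 6.
    + destruct (K 0) as (z0 & _ & _ & Hu & _). assert (HuZ := AZ _ Hu).
      destruct (DY u (ZY _ HuZ)) as (c & Hc). destruct (DZ u HuZ) as (c' & Hc').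
      destruct (upper_bound c c') as (d & Lc & Lc').
      destruct (K d) as (z & Hz & L & _ & D). apply HZ' in Hz. destruct Hz as [Hz _].
      destruct D as [D|D]; [apply Hc in D; auto|apply Hc' in D; auto];
        apply (lt_irrefl z); eauto using lt_trans.
  - do 3 right. intros x y Hx Hy N. destruct (lt_total x y) as [L|[L|L]]; [|easy|].
    + apply HA in Hy. now apply Hy.
    + apply HA in Hx. now apply Hx.
Qed.

(** * Topologies of chains *)

(** Open sets are closed upwards in the numerical order, so a nonempty one is the final segment from
    its least element. *)
Lemma chain_final T : is_csc M T -> infinite M (pts M T) ->
  (forall x y, x ∈ pts M T -> y ∈ pts M T -> x < y -> closes T x y /\ ~ closes T y x) ->
  final_segment_topology M T.
Proof.
  intros HT Hinf ch. split; [assumption|].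
  destruct (increasing_enumeration _ Hinf) as (H & HB & mono).
  exists H. split; [assumption|]. destruct HB as (B1 & B2 & B3).
  assert (HP : forall i x, pair M i x ∈ H -> x ∈ pts M T).
  { intros i x K. destruct (B1 _ K) as (i' & x' & Hx & E).
    apply pair_inj in E. now destruct E as [_ ->]. }
  assert (monole : forall i j x y, pair M i x ∈ H -> pair M j y ∈ H -> (i <= j <-> x <= y)).
  { intros i j x y Hx Hy. rewrite <- !not_lt. now rewrite (mono _ _ _ _ Hy Hx). }
  intros A. rewrite open_set_iff. split.
  - intros [AT op]. destruct (classic (exists x, x ∈ A)) as [[x0 Hx0]|N];
      [right; right|left; intros x Hx; apply N; eauto].
    destruct (least (fun x => x ∈ A) x0) as (x & Hx & min); [apply sig1_def; def|assumption|].
    destruct (B3 x (AT _ Hx)) as (j & Hj & _). exists j. intros y. split.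
    + intros Hy. destruct (B3 y (AT _ Hy)) as (i & Hi & _). exists i. split; [|assumption].
      apply (monole _ _ _ _ Hj Hi), not_lt. intros L. now apply (min y).
    + intros (i & L & Hi). apply (monole _ _ _ _ Hj Hi) in L. destruct L as [L| <-]; [|assumption].
      destruct (op x Hx) as (n & Hn & K). apply K.
      apply (ch x y); [auto|now apply HP in Hi|assumption|assumption].
  - intros [N|[E|[j E]]].
    + split; intros x Hx; now elim (N x).
    + split; intros x Hx; [now apply E|]. apply E in Hx. destruct HT as (H1 & H2 & HT).
      destruct (H2 x Hx) as [n Hn]. exists n. split; [assumption|].
      intros y Hy. apply E. apply (inU_pts T y n); [now split|assumption].
    + split.
      * intros x Hx. apply E in Hx. destruct Hx as (i & _ & Hi). eauto.
      * destruct (B2 j) as (x & Hx & _).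
        (* For [j = 0] any basic neighbourhood of [x] will do. Otherwise one omitting the
           predecessor [w] of [x] is taken: it has no point at or below [w], since by upward closure
           it would then contain [w]. *)
        assert (K : exists n, inU M T x n /\ forall y, inU M T y n -> x <= y).
        { destruct (zero_or_succ j) as [->|[k ->]].
          - destruct (proj1 (proj2 HT) x (HP _ _ Hx)) as [n Hn]. exists n.
            split; [assumption|]. intros y Hy.
            destruct (B3 y (inU_pts T y n HT Hy)) as (i & Hi & _).
            apply (monole _ _ _ _ Hx Hi), zero_le.
          - destruct (B2 k) as (w & Hw & _).
            assert (L : w < x) by (apply (mono _ _ _ _ Hw Hx), lt_plus1).
            destruct (not_closes T x w) as (n & Un & Vn).
            { apply ch; eauto. }
            exists n. split; [assumption|]. intros y Hy. assert (Py := inU_pts T y n HT Hy).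
            destruct (B3 y Py) as (i & Hi & _). apply (monole _ _ _ _ Hx Hi), succ_le.
            apply (mono _ _ _ _ Hw Hi). apply NNPP. intros C. apply not_lt in C. apply Vn.
            destruct C as [C|<-]; [|assumption]. apply (ch y w); eauto. }
        destruct K as (n & Un & K). intros y Hy. apply E in Hy. destruct Hy as (i & L & Hi).
        exists n. split.
        -- apply (monole _ _ _ _ Hx Hi) in L. destruct L as [L| <-]; [|assumption].
           apply (ch x y); eauto.
        -- intros z Hz. apply E. destruct (B3 z (inU_pts T z n HT Hz)) as (k & Hk & _).
           exists k. split; [|assumption]. apply (monole _ _ _ _ Hx Hk). auto.
Qed.

(** Dually, open sets are closed downwards, and a proper one consists of the points before the least
    missing point. *)
Lemma chain_initial T : is_csc M T -> infinite M (pts M T) ->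
  (forall x y, x ∈ pts M T -> y ∈ pts M T -> x < y -> closes T y x /\ ~ closes T x y) ->
  initial_segment_topology M T.
Proof.
  intros HT Hinf ch. split; [assumption|].
  destruct (increasing_enumeration _ Hinf) as (H & HB & mono).
  exists H. split; [assumption|]. destruct HB as (B1 & B2 & B3).
  assert (HP : forall i x, pair M i x ∈ H -> x ∈ pts M T).
  { intros i x K. destruct (B1 _ K) as (i' & x' & Hx & E).
    apply pair_inj in E. now destruct E as [_ ->]. }
  assert (monole : forall i j x y, pair M i x ∈ H -> pair M j y ∈ H -> (i <= j <-> x <= y)).
  { intros i j x y Hx Hy. rewrite <- !not_lt. now rewrite (mono _ _ _ _ Hy Hx). }
  intros A. rewrite open_set_iff. split.
  - intros [AT op].
    assert (down : forall x y, y ∈ A -> x ∈ pts M T -> x <= y -> x ∈ A).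
    { intros x y Hy Hx [L| ->]; [|assumption]. destruct (op y Hy) as (n & Hn & K). apply K.
      apply (ch x y); auto. }
    destruct (classic (exists x, x ∈ pts M T /\ ~ x ∈ A)) as [(x0 & Hx0)|N].
    + destruct (least (fun x => x ∈ pts M T /\ ~ x ∈ A) x0) as (x & (Hx & Nx) & min);
        [apply sig1_def; def|assumption|].
      assert (AE : forall y, y ∈ A <-> y ∈ pts M T /\ y < x).
      { intros y. split.
        - intros Hy. split; [auto|]. apply not_le. intros L. eauto.
        - intros [Hy L]. apply NNPP. intros Ny. apply (min y L). auto. }
      (* If the least missing point has index 0, then [A] is empty; if it has index [j + 1], then
         [A] is the initial segment up to and including [j]. *)
      destruct (B3 x Hx) as (k & Hk & _). destruct (zero_or_succ k) as [->|[j ->]].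
      * left. intros y Hy. apply AE in Hy. destruct Hy as [Hy L].
        destruct (B3 y Hy) as (i & Hi & _). apply (mono _ _ _ _ Hi Hk) in L.
        now apply (lt_zero _ axioms) in L.
      * right; right. exists j. intros y. rewrite AE. split.
        -- intros [Hy L]. destruct (B3 y Hy) as (i & Hi & _). exists i.
           split; [|assumption]. apply lt_le. now apply (mono _ _ _ _ Hi Hk).
        -- intros (i & L & Hi). split; [eauto|]. apply (mono _ _ _ _ Hi Hk). now apply lt_le.
    + right; left. intros x. split; [auto|]. intros Hx. apply NNPP. eauto.
  - intros [N|[E|[j E]]].
    + split; intros x Hx; now elim (N x).
    + split; intros x Hx; [now apply E|]. apply E in Hx.
      destruct (proj1 (proj2 HT) x Hx) as [n Hn]. exists n. split; [assumption|].
      intros y Hy. apply E. now apply (inU_pts T y n).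
    + split.
      * intros x Hx. apply E in Hx. destruct Hx as (i & _ & Hi). eauto.
      * destruct (B2 j) as (x & Hx & _). destruct (B2 (j + 1)) as (w & Hw & _).
        assert (L : x < w) by (apply (mono _ _ _ _ Hx Hw), lt_plus1).
        (* A basic neighbourhood of the last point [x] that omits its successor [w] is exactly the
           segment, by downward closure. *)
        destruct (not_closes T x w) as (n & Un & Vn); [apply ch; eauto|].
        intros y Hy. apply E in Hy. destruct Hy as (i & Li & Hi). exists n. split.
        -- apply (monole _ _ _ _ Hi Hx) in Li. destruct Li as [Li|Li]; [|now rewrite Li].
           apply (ch y x); eauto.
        -- intros z Hz. apply E. assert (Pz := inU_pts T z n HT Hz).
           destruct (B3 z Pz) as (k & Hk & _). exists k. split; [|assumption].
           apply lt_le, (mono _ _ _ _ Hk Hw), not_le. intros C. apply Vn.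
           destruct C as [C| ->]; [|assumption]. apply (ch w z); eauto.
Qed.

(** * The two implications *)

Lemma GScl_of_GST1 : GST1 M -> GScl M.
Proof.
  intros G S HS HX [C HC].
  assert (CE : forall x y, x ∈ pts M S -> y ∈ pts M S -> (pair M x y ∈ C <-> closes S x y)).
  { intros x y Hx Hy. rewrite HC, closes_basic. split.
    - intros (x' & y' & _ & _ & E & K). apply pair_inj in E. now destruct E as [-> ->].
    - intros K. eauto 6. }
  destruct (preorder_subset (pts M S) (fun x y => pair M x y ∈ C)) as (A & AS & HA & D);
    try assumption.
  - def.
  - intros x y z K L. apply HC in K, L. destruct K as (x' & y' & Hx & Hy & E & K).
    destruct L as (y'' & z' & _ & Hz & E' & L). apply pair_inj in E, E'.
    destruct E as [-> ->]. destruct E' as [-> ->]. apply HC. exists x', z'.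
    repeat split; auto.
  - destruct (subspace_exists S A AS) as (T & HT & <-).
    assert (CT := subspace_csc T S HT HS).
    assert (TE : forall x y, x ∈ pts M T -> y ∈ pts M T -> (pair M x y ∈ C <-> closes T x y)).
    { intros x y Hx Hy. rewrite (closes_sub T S x y HT Hx Hy). auto. }
    destruct D as [D|[D|[D|D]]].
    + exists T. do 2 (split; [assumption|]). left. intros B [n HB].
      destruct (classic (exists x, x ∈ B)) as [[x Hx]|N]; [right|left; intros x Hx; eauto].
      intros y. split; [intros Hy; apply HB in Hy; eauto using inU_pts|]. intros Hy.
      destruct (classic (x = y)) as [<-|N]; [assumption|]. apply HB in Hx. apply HB.
      assert (Px := inU_pts T x n CT Hx). specialize (D x y Px Hy N).
      apply TE in D; auto.
    (* Along an ascending chain a basic set containing a point contains all later ones, which is why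
       it carries the final and not the initial segment topology. *)
    + exists T. do 2 (split; [assumption|]). right; right; left. apply chain_final; auto.
      intros x y Hx Hy L. rewrite <- !TE by assumption. auto.
    + exists T. do 2 (split; [assumption|]). right; left. apply chain_initial; auto.
      intros x y Hx Hy L. rewrite <- !TE by assumption. auto.
    + destruct (G T CT HA) as (T' & HT' & K).
      * apply T1_closes. intros x y Hx Hy N. rewrite <- TE by assumption. auto.
      * exists T'. split; [now apply (subspace_trans T' T S)|assumption].
Qed.

Lemma GST1_of_GScl : GScl M -> GST1 M.
Proof.
  intros G S HS HX HT. apply G; try assumption.
  destruct (def_comp (fun z => exists x, x < z + 1 /\ x ∈ pts M S /\ z = pair M x x))
    as [C HC]; [def|].
  exists C. intros z. rewrite HC. split.
  - intros (x & _ & Hx & ->). exists x, x. auto.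
  - intros (y & x & Hy & Hx & -> & K). assert (y = x) as ->.
    { apply NNPP. intros N. rewrite T1_closes in HT. apply (HT y x Hy Hx N).
      now apply closes_basic. }
    exists x. split; [apply lt_le, pair_le|]. auto.
Qed.

End Model.

Theorem theorem4p8 (M : L2struct) : RCA0 M -> (GST1 M <-> GScl M).
Proof.
  intros HM. split; intros G S HS.
  (* The points of the given space serve as the set [W]. *)
  - apply (GScl_of_GST1 HM (pts M S) G S HS).
  - apply (GST1_of_GScl HM (pts M S) G S HS).
Qed.
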